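(* A right-angled Artin group can be isometrically embedded in a finite product of locally finite trees if and only if it is a (finite) direct product of finite-rank free groups.
   Context: For a simplicial graph $\Gamma$ (not assumed finite), the right-angled Artin group $A_\Gamma$ has one generator for each vertex of $\Gamma$, with relations that two generators commute whenever the corresponding vertices are adjacent; it carries the word metric of this generating set. Trees are simplicial trees with the path metric, and products of trees carry the $\ell^1$-metric. Isometric embeddings preserve distances exactly. *)

(* Defs.v *)
From HB Require Import structures.
From mathcomp Require Import all_boot all_order all_algebra.
From mathcomp Require Import generic_quotient.
From mathcomp Require Import all_classical all_reals.

Set Implicit Arguments.
Unset Strict Implicit.
Unset Printing Implicit Defensive.

Import Order.TTheory GRing.Theory Num.Theory.

Local Open Scope classical_set_scope.
Local Open Scope group_scope.

(* The least element of A; the value 0 for empty A is junk. *)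
Definition least (A : set nat) : nat :=
  xget 0%N [set n | A n /\ forall m, A m -> (n <= m)%N].

(* Vertex sets are choiceTypes: classically every type is one, so arbitrary
   (in particular infinite, of any cardinality) graphs are covered. *)
Record sgraph := SGraph {
  vert :> choiceType;
  adj : rel vert;
  adj_sym : symmetric adj;
  adj_irr : irreflexive adj
}.

(* (x, true) stands for the generator x and (x, false) for its inverse. *)
Definition word (X : choiceType) : choiceType := seq (X * bool).

Section Presentation.
Variables (X : choiceType) (rels : set (word X)).

Inductive pres_eq : word X -> word X -> Prop :=
| pres_refl w : pres_eq w w
| pres_sym w1 w2 : pres_eq w1 w2 -> pres_eq w2 w1
| pres_trans w1 w2 w3 : pres_eq w1 w2 -> pres_eq w2 w3 -> pres_eq w1 w3
| pres_cancel u v x b : pres_eq (u ++ [:: (x, b); (x, ~~ b)] ++ v) (u ++ v)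
| pres_rel u v r : rels r -> pres_eq (u ++ r ++ v) (u ++ v).

Definition pres_eqb : rel (word X) := fun w1 w2 => `[< pres_eq w1 w2 >].

Lemma pres_eqb_refl : reflexive pres_eqb.
Proof. by move=> w; apply/asboolP; exact: pres_refl. Qed.

Lemma pres_eqb_sym : symmetric pres_eqb.
Proof. by move=> u v; apply/asboolP/asboolP; exact: pres_sym. Qed.

Lemma pres_eqb_trans : transitive pres_eqb.
Proof.
by move=> v u w /asboolP uv /asboolP vw; apply/asboolP; exact: pres_trans vw.
Qed.

Canonical pres_equiv : equiv_rel (word X) :=
  EquivRel pres_eqb pres_eqb_refl pres_eqb_sym pres_eqb_trans.

Definition presented : Type := {eq_quot pres_equiv}%qT.
HB.instance Definition _ := Choice.on presented.
HB.instance Definition _ := Quotient.on presented.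
HB.instance Definition _ := EqQuotient.on presented.

(* The element of the presented group spelled by a word. *)
Definition spell (w : word X) : presented := (\pi_presented w)%qT.

Lemma spellP u v : spell u = spell v <-> pres_eq u v.
Proof.
split=> [/eqmodP/asboolP //|uv].
by apply/eqmodP/asboolP.
Qed.

Lemma spell_repr g : spell (repr g) = g.
Proof. exact: reprK. Qed.

Definition winv (w : word X) : word X := rev [seq (p.1, ~~ p.2) | p <- w].

Lemma pres_ctx a c u v : pres_eq u v -> pres_eq (a ++ u ++ c) (a ++ v ++ c).
Proof.
elim=> [w|w1 w2 _|w1 w2 w3 _ IH1 _|u' v' x b|u' v' r rr].
- exact: pres_refl.
- exact: pres_sym.
- exact: pres_trans.
- by have := pres_cancel (a ++ u') (v' ++ c) x b; rewrite -!catA.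
- by have := pres_rel (a ++ u') (v' ++ c) rr; rewrite -!catA.
Qed.

Lemma pres_cat u u' v v' :
  pres_eq u u' -> pres_eq v v' -> pres_eq (u ++ v) (u' ++ v').
Proof.
move=> uu vv; apply: (@pres_trans _ (u' ++ v)).
  exact: (pres_ctx [::] v uu).
by have := pres_ctx u' [::] vv; rewrite !cats0.
Qed.

Lemma winvK : involutive winv.
Proof.
move=> w; rewrite /winv map_rev revK -map_comp -[RHS]map_id.
by apply: eq_map => -[x b] /=; rewrite negbK.
Qed.

Lemma pres_winvr w : pres_eq (w ++ winv w) [::].
Proof.
elim: w => [|[x b] w IH]; first exact: pres_refl.
rewrite /winv /= rev_cons -cats1 -/(winv w) catA.
apply: pres_trans (pres_cancel [::] [::] x b).
by have := pres_ctx [:: (x, b)] [:: (x, ~~ b)] IH; rewrite /= -catA.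
Qed.

Lemma pres_winvl w : pres_eq (winv w ++ w) [::].
Proof. by rewrite -{2}[w]winvK; exact: pres_winvr. Qed.

Lemma pres_winv u v : pres_eq u v -> pres_eq (winv u) (winv v).
Proof.
move=> uv; apply: (@pres_trans _ (winv u ++ (v ++ winv v))).
  apply: pres_sym; have := pres_cat (pres_refl (winv u)) (pres_winvr v).
  by rewrite cats0.
rewrite catA; have := pres_cat
  (pres_cat (pres_refl (winv u)) (pres_sym uv)) (pres_refl (winv v)).
move/pres_trans; apply.
exact: (pres_cat (pres_winvl u) (pres_refl (winv v))).
Qed.

Definition pmul (g h : presented) : presented := spell (repr g ++ repr h).
Definition pone : presented := spell [::].
Definition pinv (g : presented) : presented := spell (winv (repr g)).

Lemma pmul_spell u v : pmul (spell u) (spell v) = spell (u ++ v).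
Proof. by apply/spellP/pres_cat; apply/spellP/spell_repr. Qed.

Lemma pinv_spell u : pinv (spell u) = spell (winv u).
Proof. by apply/spellP/pres_winv/spellP/spell_repr. Qed.

Lemma pmulA : associative pmul.
Proof.
move=> f g h; rewrite -[f]spell_repr -[g]spell_repr -[h]spell_repr.
by rewrite !pmul_spell catA.
Qed.

Lemma pmul1g : left_id pone pmul.
Proof. by move=> g; rewrite -[g]spell_repr pmul_spell. Qed.

Lemma pmulg1 : right_id pone pmul.
Proof. by move=> g; rewrite -[g]spell_repr pmul_spell cats0. Qed.

Lemma pmulVg : left_inverse pone pinv pmul.
Proof.
move=> g; rewrite -[g]spell_repr pinv_spell pmul_spell.
exact/spellP/pres_winvl.
Qed.

Lemma pmulgV : right_inverse pone pinv pmul.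
Proof.
move=> g; rewrite -[g]spell_repr pinv_spell pmul_spell.
exact/spellP/pres_winvr.
Qed.

HB.instance Definition _ :=
  isGroup.Build presented pmulA pmul1g pmulg1 pmulVg pmulgV.

(* The (left-invariant) word metric for the generating set X. *)
Definition word_dist (g h : presented) : nat :=
  least [set size w | w in [set w | spell w = g^-1 * h]].

End Presentation.

Definition raag (G : sgraph) : groupType :=
  presented [set w : word G | exists x y, adj x y /\
    w = [:: (x, true); (y, true); (x, false); (y, false)]].

Definition free_group (X : choiceType) : groupType :=
  presented (set0 : set (word X)).

Section DirectProduct.
Variables (I : finType) (F : I -> groupType).

Definition dirprod : Type := {dffun forall i, F i}.
HB.instance Definition _ := Choice.on dirprod.

Definition dp_mul (f g : dirprod) : dirprod := [ffun i => f i * g i].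
Definition dp_one : dirprod := [ffun i => 1].
Definition dp_inv (f : dirprod) : dirprod := [ffun i => (f i)^-1].

Lemma dp_mulA : associative dp_mul.
Proof. by move=> f g h; apply/ffunP => i; rewrite !ffunE mulgA. Qed.
Lemma dp_mul1g : left_id dp_one dp_mul.
Proof. by move=> f; apply/ffunP => i; rewrite !ffunE mul1g. Qed.
Lemma dp_mulg1 : right_id dp_one dp_mul.
Proof. by move=> f; apply/ffunP => i; rewrite !ffunE mulg1. Qed.
Lemma dp_mulVg : left_inverse dp_one dp_inv dp_mul.
Proof. by move=> f; apply/ffunP => i; rewrite !ffunE mulVg. Qed.
Lemma dp_mulgV : right_inverse dp_one dp_inv dp_mul.
Proof. by move=> f; apply/ffunP => i; rewrite !ffunE mulgV. Qed.

HB.instance Definition _ :=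
  isGroup.Build dirprod dp_mulA dp_mul1g dp_mulg1 dp_mulVg dp_mulgV.

End DirectProduct.

Definition isomorphic (A B : groupType) : Prop :=
  exists f : {multiplicative A -> B}, bijective f.

Definition is_tree (T : sgraph) : Prop :=
  [/\ inhabited T,
      forall x y : T, exists2 p, path (@adj T) x p & last x p = y
    & forall c : seq T, ucycle (@adj T) c -> (size c <= 2)%N].

Definition locally_finite (T : sgraph) : Prop :=
  forall x : T, finite_set [set y | adj x y].

Definition graph_dist (T : sgraph) (x y : T) : nat :=
  least [set size p | p in [set p | path (@adj T) x p /\ last x p = y]].

Local Open Scope ring_scope.

Section Realization.
Variables (R : realType) (T : sgraph).

(* A point of the geometric realization of T (edges have length 1): the point
   at distance [pos] from [src] on the edge from [src] to [tgt], or, when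
   [src = tgt] and [pos = 0], the vertex [src].  Several codes may denote the
   same point; they are exactly those at [path_dist] zero, so [path_dist] is a
   pseudometric on codes. *)
Record tree_point := TreePoint {
  src : T;
  tgt : T;
  pos : R;
  pos_ge0 : 0 <= pos;
  pos_le1 : pos <= 1;
  point_wf : adj src tgt || (src == tgt) && (pos == 0)
}.

Definition vertex_dist (v : T) (p : tree_point) : R :=
  Num.min ((graph_dist v (src p))%:R + pos p)
          ((graph_dist v (tgt p))%:R + (1 - pos p)).

(* The path metric of the realization of a tree: two points of a common edge
   are joined inside it; otherwise a path leaves through an endpoint. *)
Definition path_dist (p q : tree_point) : R :=
  if (src p == src q) && (tgt p == tgt q) then `|pos p - pos q|
  else if (src p == tgt q) && (tgt p == src q) then `|pos p - (1 - pos q)|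
  else Num.min (pos p + vertex_dist (src p) q)
               ((1 - pos p) + vertex_dist (tgt p) q).

End Realization.

(* The l^1-metric on a finite product of realized graphs. *)
Definition l1_dist (R : realType) (k : nat) (T : 'I_k -> sgraph)
    (p q : forall i, tree_point R (T i)) : R :=
  \sum_(i < k) path_dist (p i) (q i).

Definition embeds_in_product_of_lf_trees (R : realType) (G : sgraph) : Prop :=
  exists (k : nat) (T : 'I_k -> sgraph)
         (f : raag G -> forall i, tree_point R (T i)),
    (forall i, is_tree (T i) /\ locally_finite (T i)) /\
    forall g h : raag G, l1_dist (f g) (f h) = (word_dist g h)%:R.

Definition is_product_of_free_groups (A : groupType) : Prop :=
  exists (k : nat) (r : 'I_k -> nat),
    isomorphic A (dirprod (fun i => free_group 'I_(r i))).

(* Main.v *)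
From HB Require Import structures.
Require Import Defs.
From mathcomp Require Import all_boot all_order all_algebra.
From mathcomp Require Import all_classical all_reals.
From mathcomp Require Import zify ring lra.

(** Both properties are equivalent to a property of the graph: it has finitely
    many vertices and non-adjacency is transitive (whenever [a] and [b] are
    adjacent, every [c] is adjacent to [a] or to [b]).  Since non-adjacency is
    reflexive and symmetric, this says that the graph is complete multipartite
    with finitely many vertices ([nonadj_classes]).

    Such a graph gives both properties.  The group is the direct product of the
    free groups on the classes ([classes_product_of_free]).  For the embedding,
    send [g], for each class, to the freely reduced word of its letters in that
    class, seen as a vertex of the tree of all words ([cons_tree]).  Right
    multiplication by a letter moves one coordinate along one edge, and
    conversely edge paths in the coordinates spell an element of the group, so
    the distances agree ([classes_embed]).

    Suppose the group is isomorphic to a product of free groups.  The graph is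
    finite because finitely many words involve finitely many vertices
    ([product_finite]).  Let [a], [b] be adjacent and [c] adjacent to neither.
    The isomorphism need not respect generators, so one uses notions that it
    preserves, namely homomorphisms to [Z] and to the integral Heisenberg group.
    In every factor the commuting components of [a] and [b] have parallel images
    in the abelianization; hence some nontrivial [a^m b^n] has a component
    that is homologically trivial there, and so commutes with that whole factor
    in every Heisenberg quotient.  A Heisenberg quotient in which [c] does not
    commute with [a], or one in which it does not commute with [b], then shows
    that the component of [c] in this factor contributes nothing to the exponent
    of [c].  Adding up the factors, that exponent is zero
    ([product_nonadj_trans]).

    Suppose the group embeds isometrically in a product of locally finite trees.
    By the triangle inequality in each coordinate, a geodesic of the group
    projects to a geodesic of each tree.  The key finiteness is [star_finite]: if
    the geodesics between the points of a family all run through one point [p]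
    of a locally finite tree, then only finitely many members of the family
    differ from [p], for they leave [p] in different directions.  Applied to the
    generators and the identity, it shows that the graph is finite
    ([embed_finite]).  Now let [a], [b] be adjacent and [c] adjacent to neither.
    A rectangle of the plane [g <a, b>] is degenerate in each tree
    ([rectangle_degenerate]), so the set of coordinates that move along the
    [a]-ray of [g] is disjoint from the corresponding set for [b].  In a
    coordinate that is constant along the [a]-ray of [g], the rays of directions
    [a] and [b] that start at [g a^n c] for different [n] form a star, so they
    are constant for all but finitely many [n].  Hence for some [n] only
    coordinates that move along the [a]-ray of [g] move along the two rays at
    [g a^n c]; the latter move disjoint nonempty sets of coordinates, so fewer
    coordinates move along the new [a]-ray.  This descent cannot go on forever
    ([edge_and_free_vertex_absurd]). *)

Set Implicit Arguments.
Unset Strict Implicit.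
Unset Printing Implicit Defensive.

Import Order.TTheory GRing.Theory Num.Theory.

Local Open Scope classical_set_scope.
Local Open Scope group_scope.

(** * Presented groups and their word metric *)

Section Presented.
Variables (X : choiceType) (rels : set (word X)).
Implicit Types u v w : word X.
Local Notation P := (presented rels).

Lemma spell_nil : spell rels [::] = 1 :> P. Proof. by []. Qed.

Lemma spell_cat u v : spell rels (u ++ v) = spell rels u * spell rels v :> P.
Proof. by rewrite -pmul_spell. Qed.

Lemma spell_cons l w : spell rels (l :: w) = spell rels [:: l] * spell rels w :> P.
Proof. by rewrite -spell_cat. Qed.

Lemma spell_winv w : spell rels (winv w) = (spell rels w)^-1 :> P.
Proof. by rewrite -pinv_spell. Qed.

Lemma spell_letter x b :
  spell rels [:: (x, b)] =
  (if b then spell rels [:: (x, true)] else (spell rels [:: (x, true)])^-1) :> P.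
Proof. by case: b => //; rewrite -spell_winv. Qed.

Section Fold.
Variables (S : Type) (act : S -> X * bool -> S) (Q : S -> Prop).
Hypothesis actQ : forall s l, Q s -> Q (act s l).
Hypothesis actK : forall s x b, Q s -> act (act s (x, b)) (x, ~~ b) = s.
Hypothesis act_rel : forall s r, rels r -> Q s -> foldl act s r = s.

Lemma foldlQ w s : Q s -> Q (foldl act s w).
Proof. by elim: w s => //= l w IH s /actQ -/(_ l)/IH. Qed.

(** If each letter is undone by its inverse and every relator acts trivially,
    then a word acts only through the element that it spells.  The invariant
    [Q] is there because free reduction of a stack of letters is invertible
    only on reduced stacks. *)
Lemma foldl_pres_eq u v : pres_eq rels u v ->
  forall s, Q s -> foldl act s u = foldl act s v.
Proof.
elim=> [//|w1 w2 _ IH s /IH -> //|w1 w2 w3 _ IH1 _ IH2 s Qs|u' v' x b s Qs|u' v' r rr s Qs].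
- by rewrite IH1 ?IH2.
- by rewrite !foldl_cat /= actK //; apply: foldlQ.
- by rewrite !foldl_cat (act_rel rr) //; apply: foldlQ.
Qed.
End Fold.

Section Lift.
Variables (H : groupType) (rho : X -> H).

Definition lval (l : X * bool) : H := if l.2 then rho l.1 else (rho l.1)^-1.
Definition wval w : H := \prod_(l <- w) lval l.

Lemma wval_cat u v : wval (u ++ v) = wval u * wval v.
Proof. by rewrite /wval big_cat. Qed.

Hypothesis rhoP : forall r, rels r -> wval r = 1.

Lemma wval_pres_eq u v : pres_eq rels u v -> wval u = wval v.
Proof.
elim=> [//|//|w1 w2 w3 _ -> _ -> //|u' v' x b|u' v' r rr].
- rewrite !wval_cat; congr (_ * _).
  rewrite -[RHS]mul1g; congr (_ * _); rewrite /wval !big_cons big_nil mulg1.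
  by case: b; rewrite /lval /= ?mulgV ?mulVg.
- by rewrite !wval_cat (rhoP rr) mul1g.
Qed.

(** The universal property of a presentation: the value of a word depends only
    on the element that it spells, so any representative will do. *)
Definition hom_lift (g : P) : H := wval (repr g).

Lemma hom_lift_spell w : hom_lift (spell rels w) = wval w.
Proof. by apply/wval_pres_eq/spellP/spell_repr. Qed.

Lemma hom_lift_gen x : hom_lift (spell rels [:: (x, true)]) = rho x.
Proof. by rewrite hom_lift_spell /wval big_seq1. Qed.

Lemma hom_liftM (g h : P) : hom_lift (g * h) = hom_lift g * hom_lift h.
Proof.
by rewrite -[g](spell_repr g) -[h](spell_repr h) -spell_cat !hom_lift_spell wval_cat.
Qed.
End Lift.

Section Morphisms.
Variables (H : groupType).

Lemma morph1 (G : groupType) (f : G -> H) : {morph f : x y / x * y} -> f 1 = 1.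
Proof. by move=> fM; apply: (mulgI (f 1)); rewrite -fM !mulg1. Qed.

Lemma morphV (G : groupType) (f : G -> H) : {morph f : x y / x * y} ->
  {morph f : x / x^-1}.
Proof.
by move=> fM x; apply: (mulgI (f x)); rewrite -fM !mulgV morph1.
Qed.

Lemma presented_ind (Q : P -> Prop) : Q 1 ->
  (forall g h, Q g -> Q h -> Q (g * h)) ->
  (forall g, Q g -> Q g^-1) ->
  (forall x, Q (spell rels [:: (x, true)])) -> forall g, Q g.
Proof.
move=> Q1 QM QV Qx g; rewrite -[g](spell_repr g).
elim: (repr g : word X) => [|[x b] w IH]; first exact: Q1.
rewrite spell_cons; apply: QM => //; rewrite spell_letter; case: b => //.
exact: QV.
Qed.

Lemma morph_ext (f f' : P -> H) :
  {morph f : x y / x * y} -> {morph f' : x y / x * y} ->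
  (forall x, f (spell rels [:: (x, true)]) = f' (spell rels [:: (x, true)])) ->
  f =1 f'.
Proof.
move=> fM fM' ff'; apply: presented_ind => [|g h|g|//].
- by rewrite !morph1.
- by rewrite fM fM' => -> ->.
- by rewrite (morphV fM) (morphV fM') => ->.
Qed.

End Morphisms.

Lemma leastP (A : set nat) n : A n -> A (least A) /\ (least A <= n)%N.
Proof.
move=> An; rewrite /least; case: xgetP => [m -> [Am mmin]|noleast].
  by split=> //; apply: mmin.
exfalso.
elim/ltn_ind: n An => n IH An; case: (noleast n); split=> // m Am.
by rewrite leqNgt; apply/negP => /IH; apply.
Qed.

Lemma word_distP (g h : P) :
  exists2 w, spell rels w = g^-1 * h & size w = word_dist g h.
Proof.
rewrite /word_dist.
have [|[w /= ww <-] _] := @leastP [set size w | w in [set w | spell rels w = g^-1 * h]]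
  (size (repr (g^-1 * h) : word X)).
  by exists (repr (g^-1 * h)) => //=; apply: spell_repr.
by exists w.
Qed.

Lemma word_dist_le (g h : P) w : spell rels w = g^-1 * h -> (word_dist g h <= size w)%N.
Proof.
by move=> ww; apply: (proj2 (@leastP _ _ _)); exists w.
Qed.

End Presented.

Definition raag_rels (G : sgraph) : set (word G) :=
  [set w : word G | exists x y, adj x y /\
    w = [:: (x, true); (y, true); (x, false); (y, false)]].

Arguments raag_rels G : clear implicits.

Section Raag.
Variable G : sgraph.
Local Notation sp := (spell (raag_rels G)).

Definition gen (x : G) : raag G := sp [:: (x, true)].

Lemma gen_comm x y : adj x y -> commute (gen x) (gen y).
Proof.
move=> xy; apply: (mulIg (gen x)^-1); apply: (mulIg (gen y)^-1).
rewrite mulgK mulgV.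
have -> : gen x * gen y * (gen x)^-1 * (gen y)^-1 =
    sp [:: (x, true); (y, true); (x, false); (y, false)] :> raag G.
  rewrite /gen -!spell_winv -mulgA -[LHS]mulgA.
  by rewrite -[X in _ = spell _ X]/([:: (x, true)] ++ [:: (y, true)] ++
    winv [:: (x, true)] ++ winv [:: (y, true)]) !spell_cat.
apply/spellP; have /(@pres_rel _ _ [::] [::]) : raag_rels G
    [:: (x, true); (y, true); (x, false); (y, false)] by exists x, y.
by rewrite cats0.
Qed.

Lemma raag_wval (H : groupType) (rho : G -> H) :
  (forall x y, adj x y -> commute (rho x) (rho y)) ->
  forall r, raag_rels G r -> wval rho r = 1.
Proof.
move=> rhoC _ [x [y [xy ->]]]; rewrite /wval !big_cons big_nil mulg1 /lval /=.
by rewrite mulgA (rhoC _ _ xy) -mulgA mulVKg mulgV.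
Qed.

End Raag.

(** * Graphs of products of free groups *)

Section Heisenberg.
Local Open Scope ring_scope.

(** The triple [(x, y, z)] is the unitriangular matrix with [x], [y] above the
    diagonal and [z] in the corner.  Homomorphisms to this group are the simplest
    way to show that two generators do not commute. *)
Definition heis : Type := (int * int * int)%type.
HB.instance Definition _ := Choice.on heis.

Definition hX (g : heis) : int := g.1.1.
Definition hY (g : heis) : int := g.1.2.

Definition heis_mul (g h : heis) : heis :=
  (hX g + hX h, hY g + hY h, g.2 + h.2 + hX g * hY h).
Definition heis_one : heis := (0, 0, 0).
Definition heis_inv (g : heis) : heis := (- hX g, - hY g, - g.2 + hX g * hY g).

Lemma heis_mulA : associative heis_mul.
Proof.
move=> [[a b] c] [[a' b'] c'] [[a'' b''] c'']; rewrite /heis_mul /hX /hY /=.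
by congr (_, _, _); ring.
Qed.
Lemma heis_mul1g : left_id heis_one heis_mul.
Proof.
move=> [[a b] c]; rewrite /heis_mul /hX /hY /=.
by congr (_, _, _); ring.
Qed.
Lemma heis_mulg1 : right_id heis_one heis_mul.
Proof.
move=> [[a b] c]; rewrite /heis_mul /hX /hY /=.
by congr (_, _, _); ring.
Qed.
Lemma heis_mulVg : left_inverse heis_one heis_inv heis_mul.
Proof.
move=> [[a b] c]; rewrite /heis_mul /heis_inv /hX /hY /=.
by congr (_, _, _); ring.
Qed.
Lemma heis_mulgV : right_inverse heis_one heis_inv heis_mul.
Proof.
move=> [[a b] c]; rewrite /heis_mul /heis_inv /hX /hY /=.
by congr (_, _, _); ring.
Qed.

HB.instance Definition _ :=
  isGroup.Build heis heis_mulA heis_mul1g heis_mulg1 heis_mulVg heis_mulgV.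

Lemma hXM (g h : heis) : hX (g * h)%g = hX g + hX h. Proof. by []. Qed.
Lemma hYM (g h : heis) : hY (g * h)%g = hY g + hY h. Proof. by []. Qed.

(** A commutator is central, and its only entry is the determinant of the
    images in the abelianization. *)
Lemma heis_commuteP (g h : heis) : commute g h <-> hX g * hY h = hX h * hY g.
Proof.
rewrite /commute /mul /= /heis_mul; split=> [[_ _]|e]; first lia.
by congr (_, _, _); move: e; rewrite /hX /hY /=; lia.
Qed.

End Heisenberg.

Section Characters.
Local Open Scope ring_scope.

Definition character (A : groupType) (chi : A -> int) : Prop :=
  forall g h, chi (g * h)%g = chi g + chi h.

Lemma character1 (A : groupType) (chi : A -> int) : character chi -> chi 1%g = 0.
Proof. by move=> chiM; have := chiM 1%g 1%g; rewrite mulg1; lia. Qed.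

Lemma characterV (A : groupType) (chi : A -> int) : character chi ->
  forall g, chi g^-1%g = - chi g.
Proof.
by move=> chiM g; have := chiM g g^-1%g; rewrite mulgV character1 //; lia.
Qed.

Lemma character_comp (A B : groupType) (chi : B -> int) (f : A -> B) :
  character chi -> {morph f : x y / (x * y)%g} -> character (chi \o f).
Proof. by move=> chiM fM g h; rewrite /= fM chiM. Qed.

Lemma hX_character : character hX. Proof. by []. Qed.

Lemma character_prod (A : groupType) (chi : A -> int) I (r : seq I) (F : I -> A) :
  character chi -> chi (\prod_(i <- r) F i)%g = \sum_(i <- r) chi (F i).
Proof. by move=> chiM; apply: (big_morph chi chiM); apply: character1. Qed.

Section Presentation.
Variables (X : choiceType) (rels : set (word X)).
Local Notation sp := (spell rels).

(** Characters replace a construction of the abelianization: an element is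
    trivial there when every character kills it. *)
Lemma character_presented0 (chi : presented rels -> int) : character chi ->
  (forall x, chi (sp [:: (x, true)]) = 0) -> forall g, chi g = 0.
Proof.
move=> chiM chi0; apply: presented_ind => [|g h|g|//].
- exact: character1.
- by rewrite chiM => -> ->.
- by rewrite characterV // => ->.
Qed.

Lemma character_ext (chi chi' : presented rels -> int) :
  character chi -> character chi' ->
  (forall x, chi (sp [:: (x, true)]) = chi' (sp [:: (x, true)])) -> chi =1 chi'.
Proof.
move=> chiM chiM' e g; apply/eqP; rewrite -subr_eq0; apply/eqP.
apply: (@character_presented0 (fun g => chi g - chi' g)) => [g1 g2|x].
  by rewrite chiM chiM'; ring.
by rewrite e subrr.
Qed.

Definition zword (x : X) (m : int) : word X := nseq `|m|%N (x, 0 <= m).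

Lemma character_zword (chi : presented rels -> int) x m : character chi ->
  chi (sp (zword x m)) = m * chi (sp [:: (x, true)]).
Proof.
move=> chiM.
have powE n b : chi (sp (nseq n (x, b))) = n%:Z * chi (sp [:: (x, b)]).
  elim: n => [|n IH]; first by rewrite mul0r character1.
  by rewrite [nseq _ _]/= spell_cons chiM IH intS mulrDl mul1r.
rewrite /zword powE spell_letter; case: (leP 0 m) => m0; first by rewrite gez0_abs.
by rewrite characterV // ltz0_abs // mulrNN.
Qed.

Lemma character_notin (chi : presented rels -> int) x w : character chi ->
  (forall z, chi (sp [:: (z, true)]) = (z == x)%:R) ->
  x \notin [seq l.1 | l <- w] -> chi (sp w) = 0.
Proof.
move=> chiM chix; elim: w => [_|[z b] w IH]; first exact: (character1 chiM).
rewrite inE negb_or spell_cons chiM => /andP[xz /IH ->].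
have zx : chi (sp [:: (z, true)]) = 0 by rewrite chix eq_sym (negPf xz).
by rewrite spell_letter; case: ifP => _; rewrite ?characterV // zx.
Qed.

Section HeisRep.
Variables (p q : X).

(** The generators [p] and [q] go to the two standard generators of the
    Heisenberg group, all others to the identity. *)
Definition heis_gen (z : X) : heis :=
  if z == p then (1, 0, 0) : heis else if z == q then (0, 1, 0) : heis else 1%g.

Definition heis_rep : presented rels -> heis := hom_lift heis_gen.

Hypothesis heis_genP : forall r, rels r -> wval heis_gen r = 1%g.

Lemma heis_repM : {morph heis_rep : x y / (x * y)%g}.
Proof. exact: hom_liftM. Qed.

Lemma heis_repX z : hX (heis_rep (sp [:: (z, true)])) = (z == p)%:R.
Proof. by rewrite /heis_rep hom_lift_gen // /heis_gen; case: eqP => // _; case: eqP. Qed.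

Lemma heis_repY z : p != q -> hY (heis_rep (sp [:: (z, true)])) = (z == q)%:R.
Proof.
rewrite /heis_rep hom_lift_gen // /heis_gen => pq; case: (eqVneq z p) => [->|_].
  by rewrite (negPf pq).
by case: eqP.
Qed.

End HeisRep.
End Presentation.

(** The standard generators are the only two values that do not commute, so the
    relators survive as soon as [p] and [q] are not adjacent. *)
Lemma raag_heis_genP (G : sgraph) (p q : G) :
  ~~ adj p q -> forall r, raag_rels G r -> wval (heis_gen p q) r = 1%g.
Proof.
move=> pq; apply: raag_wval => x y xy; rewrite /heis_gen.
case: (eqVneq x p) => [xp|_]; case: (eqVneq y p) => [yp|_].
- by [].
- case: (eqVneq y q) => [yq|_]; last exact: commute1.
  by move: xy; rewrite xp yq (negPf pq).
- case: (eqVneq x q) => [xq|_]; last exact/commute_sym/commute1.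
  by move: xy; rewrite xq yp adj_sym (negPf pq).
- case: (x == q); last exact/commute_sym/commute1.
  by case: (y == q) => //; exact: commute1.
Qed.

Section Free.
Variable r : nat.
Local Notation F := (free_group 'I_r).
Local Notation sp := (spell (set0 : set (word 'I_r))).
Local Notation frep := (@heis_rep _ (set0 : set (word 'I_r))).

Let exponent (k : 'I_r) (g : F) : int := hX (frep k k g).

Let frepM k l : {morph frep k l : x y / (x * y)%g}.
Proof. exact: heis_repM. Qed.

Lemma free_character (chi : F -> int) g : character chi ->
  chi g = \sum_k exponent k g * chi (sp [:: (k, true)]).
Proof.
move=> chiM; move: g; apply: character_ext => // [g h|x].
  rewrite -big_split; apply: eq_bigr => k _.
  by rewrite /exponent frepM hXM mulrDl.
rewrite (bigD1 x) //= big1 ?addr0 => [|k kx]; rewrite /exponent heis_repX //.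
  by rewrite eqxx mul1r.
by rewrite eq_sym (negPf kx) mul0r.
Qed.

(** The images in the abelianization are parallel, since each 2 by 2 minor of
    their exponents is the determinant computed in a Heisenberg quotient.  If
    [g] has a nonzero exponent, then this one and the corresponding exponent of
    [h] are the coefficients of the relation. *)
Lemma free_commute_dependent (g h : F) : commute g h ->
  exists m n : int, (m != 0) || (n != 0) /\
    forall chi : F -> int, character chi -> m * chi g + n * chi h = 0.
Proof.
move=> gh.
have par k l : exponent k g * exponent l h = exponent k h * exponent l g.
  case: (eqVneq k l) => [->|kl]; first ring.
  have /heis_commuteP : commute (frep k l g) (frep k l h).
    by rewrite /commute -!frepM gh.
  have EX x : hX (frep k l x) = exponent k x.
    move: x; apply: character_ext => [x y|x y|x]; rewrite ?frepM ?heis_repX //.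
      by rewrite /exponent frepM.
    by rewrite /exponent heis_repX.
  have EY x : hY (frep k l x) = exponent l x.
    move: x; apply: character_ext => [x y|x y|x]; rewrite ?frepM ?heis_repY //.
      by rewrite /exponent frepM.
    by rewrite /exponent heis_repX.
  by rewrite !EX !EY.
have [g0|] := pselect (forall k, exponent k g = 0).
  exists 1, 0; split=> // chi chiM; rewrite mul0r addr0 mul1r free_character //.
  by rewrite big1 // => k _; rewrite g0 mul0r.
move=> /existsNP[k /eqP gk].
exists (- exponent k h), (exponent k g); rewrite gk orbT; split=> // chi chiM.
rewrite !(free_character _ chiM) !mulr_sumr -big_split big1 //= => l _.
by rewrite mulNr !mulrA par addNr.
Qed.
End Free.
End Characters.

Section DirProd.
Variables (I : finType) (F : I -> groupType).
Local Notation P := (dirprod F).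
Implicit Types (p q : P).

Lemma dp_mulE p q i : (p * q) i = p i * q i. Proof. by rewrite ffunE. Qed.
Lemma dp_oneE i : (1 : P) i = 1. Proof. by rewrite ffunE. Qed.

Definition emb (i : I) (x : F i) : P := [ffun j => eqtype.dfwith (fun j => 1 : F j) x j].

Lemma emb_in i (x : F i) : emb x i = x.
Proof. by rewrite ffunE dfwith_in. Qed.

Lemma emb_out i j (x : F i) : i != j -> emb x j = 1.
Proof. by move=> ij; rewrite ffunE dfwith_out. Qed.

Lemma embM i : {morph @emb i : x y / x * y}.
Proof.
move=> x y; apply/ffunP => j; rewrite dp_mulE.
case: (eqVneq i j) => [<-|ij]; first by rewrite !emb_in.
by rewrite !emb_out // mulg1.
Qed.

(** Factors of a direct product commute with everything that is trivial in
    their own coordinate. *)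
Lemma emb_commute i (x : F i) p : p i = 1 -> commute (emb x) p.
Proof.
move=> pi1; apply/ffunP => j; rewrite !dp_mulE.
case: (eqVneq i j) => [<-|ij]; first by rewrite pi1 mulg1 mul1g.
by rewrite emb_out // mulg1 mul1g.
Qed.

Lemma prodg_single (H : groupType) (r : seq I) (E : I -> H) j : uniq r -> j \in r ->
  (forall i, i != j -> E i = 1) -> \prod_(i <- r) E i = E j.
Proof.
move=> + + E1; elim: r => //= i r IH /andP[ir ur]; rewrite inE big_cons.
case: (eqVneq j i) => [ji _|ji /= jr].
  rewrite -ji in ir *; rewrite big_seq big1 ?mulg1 // => k kr; apply: E1.
  by apply: contraNneq ir => <-.
by rewrite E1 1?eq_sym // mul1g IH.
Qed.

Lemma dp_prod_emb p : p = \prod_i emb (p i).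
Proof.
apply/ffunP => j.
have -> : (\prod_i emb (p i)) j = \prod_i (emb (p i) j).
  by apply: (big_morph (fun p : P => p j)) => [q q'|]; rewrite ?dp_mulE ?dp_oneE.
rewrite (prodg_single (index_enum_uniq I) (mem_index_enum j)) ?emb_in // => i ij.
exact: emb_out.
Qed.
End DirProd.

Section ProductOfFree.
Variables (G : sgraph) (k : nat) (r : 'I_k -> nat).
Local Notation F := (fun i => free_group 'I_(r i)).
Local Notation P := (dirprod F).
Variables (phi : raag G -> P) (phi' : P -> raag G).
Hypotheses (phiM : {morph phi : x y / x * y}) (phiK : cancel phi phi')
  (phiK' : cancel phi' phi).

Let phi'M : {morph phi' : x y / x * y}.
Proof. by move=> p q; rewrite -{1}[p]phiK' -{1}[q]phiK' -phiM phiK. Qed.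

(** A character adds up its values on the components in the factors.  This is
    where a generator of the graph group gets distributed over the factors. *)
Lemma character_components (chi : raag G -> int) g : character chi ->
  chi g = (\sum_i chi (phi' (emb (phi g i))))%R.
Proof.
move=> chiM; rewrite -{1}[g]phiK {1}[phi g]dp_prod_emb.
exact: (character_prod (index_enum 'I_k) (fun i => emb (phi g i)) (character_comp chiM phi'M)).
Qed.

Let support : seq G :=
  flatten [seq flatten [seq [seq l.1 | l <- (repr (phi' (emb
     (spell set0 [:: (j, true)] : F i))) : word G)] | j <- enum 'I_(r i)] | i <- enum 'I_k].

(** The exponent of a vertex outside of the support vanishes on the images of
    all free bases, hence on every component, hence everywhere; but it is 1 on
    the vertex itself. *)
Lemma product_finite : finite_set [set: G].
Proof.
apply: (@sub_finite_set _ _ [set` support]); last exact: finite_seq.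
move=> x _ /=; apply: contrapT => /negP xsupp.
have xx : ~~ adj x x by rewrite adj_irr.
pose chi : raag G -> int := hX \o @heis_rep _ (raag_rels G) x x.
have chiM : character chi by apply: character_comp => //; apply/heis_repM/raag_heis_genP.
have chix z : chi (gen z) = (z == x)%:R%R by apply/heis_repX/raag_heis_genP.
suff : chi (gen x) = 0%R by rewrite chix eqxx.
rewrite character_components // big1 // => i _.
move: (phi (gen x) i); apply: (@character_presented0 _ set0 (fun y => chi (phi' (@emb _ F i y)))).
  by move=> y y'; rewrite embM phi'M chiM.
move=> j; rewrite -[phi' _](@spell_repr _ (raag_rels G)); apply: character_notin chix _ => //.
apply: contra xsupp => xw; apply/flatten_mapP; exists i; first by rewrite mem_enum.
by apply/flatten_mapP; exists j; rewrite ?mem_enum.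
Qed.

(** In each factor some [g = a^m b^n] has a homologically trivial component,
    which is central in every Heisenberg image of the factor.  There [g] commutes
    with the component [delta] of [c], and comparing determinants shows that [m]
    or [n] times the exponent of [c] in [delta] vanishes. *)
Lemma product_nonadj_trans (a b c : G) : adj a b -> adj a c || adj b c.
Proof.
move=> ab; apply: contraT; rewrite negb_or => /andP[nac nbc].
have ac : a != c by apply: contraNneq nbc => <-; rewrite adj_sym.
have bc : b != c by apply: contraNneq nac => <-.
have aNb : a != b by apply: contraTneq ab => ->; rewrite adj_irr.
(* For [p = a] and for [p = b] this is the exponent of [c]; the two differ only
   in the Heisenberg quotient that they come from. *)
pose chi (p : G) : raag G -> int := hY \o @heis_rep _ (raag_rels G) p c.
have repM (p : G) : ~~ adj p c -> {morph @heis_rep _ (raag_rels G) p c : x y / x * y}.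
  by move=> pc; apply/heis_repM/raag_heis_genP.
have chiM p : ~~ adj p c -> character (chi p).
  by move=> pc; apply: character_comp => //; apply: repM.
have chi_gen p z : ~~ adj p c -> p != c -> chi p (gen z) = (z == c)%:R%R.
  by move=> pc pNc; apply: heis_repY => //; apply: raag_heis_genP.
have chi_ab : chi a =1 chi b.
  by apply: character_ext => [||x]; [exact: chiM|exact: chiM|rewrite !chi_gen].
have : chi a (gen c) = 1%R by rewrite chi_gen // eqxx.
rewrite character_components ?big1; [by []| |exact: chiM] => i _.
set delta := phi' _.
have [m [n [mn dep]]] : exists m n : int, (m != 0)%R || (n != 0)%R /\
    forall ch : F i -> int, character ch ->
    (m * ch (phi (gen a) i) + n * ch (phi (gen b) i) = 0)%R.
  apply: free_commute_dependent; rewrite /commute -!dp_mulE -!phiM.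
  by rewrite (gen_comm ab).
pose g : raag G := spell (raag_rels G) (zword a m) * spell (raag_rels G) (zword b n).
have zero (ch : F i -> int) : character ch -> ch (phi g i) = 0%R.
  move=> chM; pose ch' (y : raag G) := ch (phi y i).
  have ch'M : character ch' by move=> x y; rewrite /ch' phiM dp_mulE chM.
  by rewrite -[LHS]/(ch' g) ch'M !character_zword //; apply: dep.
have key p : ~~ adj p c -> p != c -> hX (heis_rep p c g) != 0%R -> chi p delta = 0%R.
  move=> pc pNc gX.
  have : commute (heis_rep p c g) (heis_rep p c delta).
    rewrite -[g]phiK; set q := phi g.
    pose f := @heis_rep _ (raag_rels G) p c \o phi'.
    have fM : {morph f : x y / x * y} by move=> x y; rewrite /f /= phi'M repM.
    rewrite -[heis_rep p c (phi' q)]/(f q) -[heis_rep p c delta]/(f (emb (phi (gen c) i))).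
    (* The component of [q] is central in the image of the factor, and the rest of
       [q] commutes with the factor. *)
    have -> : q = emb (q i) * ((emb (q i))^-1 * q) by rewrite mulVKg.
    rewrite [f (_ * _)]fM; apply/commute_sym/commuteM.
      apply/heis_commuteP.
      have -> : hX (f (emb (q i))) = 0%R.
        apply: (zero (fun y => hX (f (@emb _ F i y)))) => x y.
        by rewrite embM fM hXM.
      have -> : hY (f (emb (q i))) = 0%R.
        apply: (zero (fun y => hY (f (@emb _ F i y)))) => x y.
        by rewrite embM fM hYM.
      by rewrite mulr0 mul0r.
    rewrite /commute -!fM; congr (f _); apply: emb_commute.
    have := mulVg (emb (q i)) => /(congr1 (fun x : P => x i)).
    by rewrite !dp_mulE emb_in dp_oneE.
  move/heis_commuteP.
  have -> : hY (heis_rep p c g) = 0%R.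
    rewrite -[LHS]/(chi p g) (chiM _ pc) !(character_zword _ _ (chiM _ pc)).
    by rewrite !chi_gen // (negPf ac) (negPf bc) !mulr0.
  by rewrite mulr0 => /eqP; rewrite mulf_eq0 (negPf gX) => /eqP.
have gX p : ~~ adj p c -> hX (heis_rep p c g) = (m * (a == p)%:R + n * (b == p)%:R)%R.
  move=> pc; pose chX : raag G -> int := hX \o @heis_rep _ (raag_rels G) p c.
  have chXM : character chX := character_comp hX_character (repM _ pc).
  rewrite -[LHS]/(chX g) chXM !(character_zword _ _ chXM) /chX /=.
  by rewrite !heis_repX //; apply: raag_heis_genP.
case/orP: mn => nz.
  by apply: key => //; rewrite gX // eqxx (eq_sym b) (negPf aNb) mulr0 addr0 mulr1.
by rewrite chi_ab; apply: key => //; rewrite gX // eqxx (negPf aNb) mulr0 add0r mulr1.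
Qed.
End ProductOfFree.

(** * Complete multipartite graphs give products of free groups *)

Section FiniteProducts.
Variables (I : eqType) (H : groupType).

Lemma prodgM_neq_commute (r : seq I) (E E' : I -> H) : uniq r ->
  (forall i j, i != j -> commute (E i) (E' j)) ->
  \prod_(i <- r) (E i * E' i) = \prod_(i <- r) E i * \prod_(i <- r) E' i.
Proof.
move=> + EE'; elim: r => [_|i r IH /= /andP[ir ur]]; first by rewrite !big_nil mulg1.
rewrite !big_cons IH // !mulgA; congr (_ * _); rewrite -!mulgA; congr (_ * _).
rewrite big_seq -[RHS]commute_prod // => j jr; apply/commute_sym/EE'.
by apply: contraNneq ir => <-.
Qed.
End FiniteProducts.

Lemma hom_commute (X X' : choiceType) (rels : set (word X)) (rels' : set (word X'))
  (H : groupType) (f : presented rels -> H) (f' : presented rels' -> H) :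
  {morph f : x y / x * y} -> {morph f' : x y / x * y} ->
  (forall x x', commute (f (spell rels [:: (x, true)])) (f' (spell rels' [:: (x', true)]))) ->
  forall g g', commute (f g) (f' g').
Proof.
move=> fM fM' ff' g g'; move: g; apply: presented_ind => [|g h|g|x].
- by rewrite morph1 //; apply/commute_sym/commute1.
- by rewrite fM => /commute_sym gg /commute_sym hh; apply/commute_sym/commuteM.
- by rewrite (morphV fM) => /commute_sym gg; apply/commute_sym/commuteV.
move: g'; apply: presented_ind => [|g h|g|//].
- by rewrite morph1 //; apply/commute1.
- by rewrite fM' => gg hh; apply/commuteM.
- by rewrite (morphV fM') => gg; apply/commuteV.
Qed.

(** Non-adjacency is an equivalence relation; a class is numbered by the
    position of its canonical representative in a list of the vertices. *)
Lemma nonadj_classes (G : sgraph) : finite_set [set: G] ->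
  (forall a b c : G, adj a b -> adj a c || adj b c) ->
  exists n (cls : G -> 'I_n), forall x y, adj x y = (cls x != cls y).
Proof.
move=> /finite_seqP[vs vsT] trans.
have memvs x : x \in vs by have : [set: G] x by []; rewrite vsT.
pose nadj (x y : G) := ~~ adj x y.
have nadjE x y : nadj x y -> nadj x =1 nadj y.
  move=> xy z; rewrite /nadj; apply/idP/idP.
    move=> xz; apply: contraNN xy => yz.
    by have := trans _ _ x yz; rewrite ![adj _ x]adj_sym (negPf xz) orbF.
  move=> yz; apply: contraNN xy => xz.
  by have := trans _ _ y xz; rewrite [adj z y]adj_sym (negPf yz) orbF.
have nadjxx x : nadj x x by rewrite /nadj adj_irr.
pose rep x := choose (nadj x) x.
have repP x : nadj x (rep x) by apply: chooseP.
have repE x y : nadj x y -> rep x = rep y.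
  move=> xy; rewrite /rep (eq_choose (nadjE _ _ xy)); apply: choose_id => //.
  by rewrite -(nadjE _ _ xy).
pose cls x := Ordinal (etrans (index_mem (rep x) vs) (memvs (rep x))).
exists (size vs), cls => x y; apply: negb_inj; rewrite negbK.
apply/idP/idP => [xy|/eqP/(congr1 val) /= e].
  by apply/eqP/val_inj; rewrite /= (repE _ _ xy).
have {}e : rep x = rep y by rewrite -(nth_index x (memvs (rep x))) e nth_index.
by rewrite -/(nadj x y) (nadjE _ _ (repP x)) e -(nadjE _ _ (repP y)).
Qed.

Section ProductIso.
Variables (G : sgraph) (vs : seq G) (n : nat) (cls : G -> 'I_n).
Hypotheses (vsP : forall x, x \in vs) (clsE : forall x y, adj x y = (cls x != cls y)).

Let members i := undup [seq x <- vs | cls x == i].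
Let r i := size (members i).
Local Notation F := (fun i => free_group 'I_(r i)).
Local Notation P := (dirprod F).

Let memP i x : (x \in members i) = (cls x == i).
Proof. by rewrite mem_undup mem_filter vsP andbT. Qed.

Let rank_lt x : (index x (members (cls x)) < r (cls x))%N.
Proof. by rewrite index_mem memP. Qed.

Let rank x : 'I_(r (cls x)) := Ordinal (rank_lt x).

Let to_gen (x : G) : P := @emb _ F (cls x) (spell set0 [:: (rank x, true)]).

Let to_genP w : raag_rels G w -> wval to_gen w = 1.
Proof.
apply: raag_wval => x y; rewrite clsE => xy; apply: emb_commute; apply: emb_out.
by rewrite eq_sym.
Qed.

Let to : raag G -> P := hom_lift to_gen.

Let toM : {morph to : x y / x * y}. Proof. exact: hom_liftM. Qed.

Let vertex i (j : 'I_(r i)) : G := tnth (in_tuple (members i)) j.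

Let cls_vertex i j : cls (@vertex i j) = i.
Proof. by apply/eqP; rewrite -memP; apply: mem_tnth. Qed.

Let index_vertex i j : index (@vertex i j) (members i) = j.
Proof.
rewrite /vertex; have x := tnth (in_tuple (members i)) j.
by rewrite (tnth_nth x) index_uniq ?undup_uniq.
Qed.

Let from_comp i : F i -> raag G := hom_lift (fun j => gen (@vertex i j)).

Let from_compM i : {morph @from_comp i : x y / x * y}.
Proof. exact: hom_liftM. Qed.

Let from_comp_gen i j : @from_comp i (spell set0 [:: (j, true)]) = gen (@vertex i j).
Proof. exact: hom_lift_gen. Qed.

Let from_comp_commute i j : i != j -> forall g h, commute (@from_comp i g) (@from_comp j h).
Proof.
move=> ij; apply: (hom_commute (@from_compM i) (@from_compM j)) => x y.
by rewrite !from_comp_gen; apply: gen_comm; rewrite clsE !cls_vertex.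
Qed.

Let from (p : P) : raag G := \prod_i from_comp (p i).

Let fromM : {morph from : x y / x * y}.
Proof.
move=> p q; rewrite /from -prodgM_neq_commute ?index_enum_uniq //.
  by apply: eq_bigr => i _; rewrite dp_mulE from_compM.
by move=> i j ij; apply: from_comp_commute.
Qed.

Let from_emb i g : from (@emb _ F i g) = from_comp g.
Proof.
rewrite /from (@prodg_single _ _ _ _ i) ?index_enum_uniq ?mem_index_enum ?emb_in //.
by move=> j ji; rewrite emb_out 1?eq_sym // morph1.
Qed.

Let toK : cancel to from.
Proof.
apply: (@morph_ext _ (raag_rels G) _ (from \o to) id) => [x y|//|x].
  by rewrite /= toM fromM.
rewrite /= /to hom_lift_gen // from_emb from_comp_gen /vertex (tnth_nth x) /=.
by rewrite nth_index // memP.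
Qed.

Let to_gen_vertex i j : to_gen (@vertex i j) = @emb _ F i (spell set0 [:: (j, true)]).
Proof.
suff H x (e : cls x = i) : x = vertex j ->
    to_gen x = @emb _ F i (spell set0 [:: (j, true)]).
  by apply: H => //; apply: cls_vertex.
(* Destructing [e] avoids a transport along [cls (vertex j) = i] in the types. *)
case: _ / e j => j xj; suff -> : j = rank x by [].
by apply: val_inj; rewrite /= [X in index X _]xj index_vertex.
Qed.

Let to_comp i g : to (@from_comp i g) = emb g.
Proof.
move: g; apply: morph_ext => [x y|x y|j].
- by rewrite from_compM toM.
- exact: embM.
- by rewrite from_comp_gen /to hom_lift_gen // to_gen_vertex.
Qed.

Let fromK : cancel from to.
Proof.
move=> p; rewrite [RHS]dp_prod_emb /from.
rewrite (big_morph to toM (morph1 toM)); apply: eq_bigr => i _; exact: to_comp.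
Qed.

(** The map [cls] need not be onto: an index outside of its image contributes
    the free group on an empty class, which is trivial. *)
Lemma classes_product_of_free : is_product_of_free_groups (raag G).
Proof.
exists n, r.
pose f : {multiplicative raag G -> P} :=
  HB.pack to (isMultiplicative.Build _ _ to toM).
by exists f; exists from; [exact: toK|exact: fromK].
Qed.
End ProductIso.

(** * Complete multipartite graphs give isometric embeddings *)

Section Stack.
Variable X : choiceType.
Implicit Types (l : X * bool) (s w : word X).

Definition linv l : X * bool := (l.1, ~~ l.2).

Lemma linvK : involutive linv.
Proof. by case=> x b; rewrite /linv /= negbK. Qed.

Definition noncancel l l' := l' != linv l.

Lemma noncancel_sym : symmetric noncancel.
Proof. by move=> l l'; rewrite /noncancel -(inj_eq (can_inj linvK)) linvK eq_sym. Qed.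

Definition reduced w := sorted noncancel w.

(** The head of the stack is the most recent letter, so that reading a letter is
    a right multiplication and moves along one edge of the tree of words. *)
Definition push s l : word X :=
  if s is l' :: s' then if l' == linv l then s' else l :: s else [:: l].

Lemma push_reduced s l : reduced s -> reduced (push s l).
Proof.
case: s => [|l' s] //= red; case: ifPn => [_|ll'] /=; first exact: path_sorted red.
by rewrite {1}/noncancel ll'.
Qed.

(** The reducedness is essential: after a cancellation the new head must not
    cancel the inverse of the letter just read. *)
Lemma pushK s l : reduced s -> push (push s l) (linv l) = s.
Proof.
case: s => [|l' s] /=; first by rewrite linvK eqxx.
move=> red; case: (eqVneq l' (linv l)) => [e|ll'] /=; last by rewrite linvK eqxx.
rewrite -e; case: s red => [|l'' s] //= /andP[].
by rewrite {1}/noncancel => /negPf ->.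
Qed.

Lemma size_push s l : (size (push s l) <= (size s).+1)%N.
Proof. by case: s => [|l' s] //=; case: ifP => _ //=; rewrite ltnW. Qed.

Lemma push_noncancel l s : reduced (l :: s) -> push s l = l :: s.
Proof.
case: s => [|l' s] //= /andP[]; rewrite /noncancel => ll' _.
by rewrite (negPf ll').
Qed.

Lemma push_all_reduced w s : reduced (catrev w s) -> foldl push s w = catrev w s.
Proof.
elim: w s => //= l w IH s red; rewrite push_noncancel ?IH //.
move: red; rewrite catrevE /reduced; by move/cat_sorted2 => [_].
Qed.

Lemma rev_reduced w : reduced (rev w) = reduced w.
Proof. by rewrite /reduced rev_sorted; apply: eq_sorted => x y; rewrite noncancel_sym. Qed.

End Stack.

Section LetterMap.
Variables (G : sgraph) (X : choiceType) (theta : G -> option (X * bool)).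
Hypothesis theta_adj : forall x y u v,
  adj x y -> theta x = Some u -> theta y = Some v -> u.1 = v.1.
Implicit Types (l : G * bool) (s : word X) (w : word G) (g : raag G).

(** A partial relabelling [theta] of the generators by letters of a free group
    sends inverses to inverses and drops the letters where it is undefined. *)
Definition theta_letter l : option (X * bool) :=
  omap (fun u => (u.1, u.2 == l.2)) (theta l.1).

Definition act s l := if theta_letter l is Some u then push s u else s.

Lemma theta_letterN x b : theta_letter (x, ~~ b) = omap (@linv X) (theta_letter (x, b)).
Proof.
rewrite /theta_letter /=; case: (theta x) => [[y c]|] //=.
by rewrite /linv /=; case: c b => [] [].
Qed.

Lemma act_reduced s l : reduced s -> reduced (act s l).
Proof. by rewrite /act; case: (theta_letter l) => // u; apply: push_reduced. Qed.

Lemma actK s x b : reduced s -> act (act s (x, b)) (x, ~~ b) = s.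
Proof.
rewrite /act theta_letterN; case: (theta_letter (x, b)) => //= u.
exact: pushK.
Qed.

(** Adjacent generators go to powers of one letter, so relabelling a relator
    gives a word that cancels. *)
Lemma act_rel s r : raag_rels G r -> reduced s -> foldl act s r = s.
Proof.
move=> [x [y [xy ->]]] red /=.
have inv z b t : reduced t -> act (act t (z, b)) (z, ~~ b) = t by apply: actK.
case ex: (theta x) => [u|]; last first.
  have xN b t : act t (x, b) = t by rewrite /act /theta_letter /= ex.
  by rewrite !xN (inv y true).
case ey: (theta y) => [v|]; last first.
  have yN b t : act t (y, b) = t by rewrite /act /theta_letter /= ey.
  by rewrite !yN (inv x true).
have uv := theta_adj xy ex ey.
(* Both letters are sent to the same letter, up to sign. *)
have [e|e] : (forall b, theta_letter (y, b) = theta_letter (x, b)) \/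
    (forall b, theta_letter (y, b) = theta_letter (x, ~~ b)).
  rewrite /theta_letter /= ex ey /= uv; case: u v {ex ey uv} => [z []] [z' []] /=;
    by [left=> -[] | right=> -[]].
- have yE b t : act t (y, b) = act t (x, b) by rewrite /act e.
  by rewrite !yE (inv x true) ?(inv x true) //; apply: act_reduced.
- have yE b t : act t (y, b) = act t (x, ~~ b) by rewrite /act e.
  by rewrite !yE /= (inv x true) // (inv x false).
Qed.

Lemma foldl_act_pres_eq w w' s : pres_eq (raag_rels G) w w' -> reduced s ->
  foldl act s w = foldl act s w'.
Proof.
move=> ww' red.
exact: (@foldl_pres_eq _ _ _ act (@reduced X) act_reduced actK act_rel _ _ ww').
Qed.

Definition stack g : word X := foldl act [::] (repr g : word G).

Lemma stack_mul g w : stack (g * spell (raag_rels G) w) = foldl act (stack g) w.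
Proof.
rewrite /stack -foldl_cat; apply: foldl_act_pres_eq => //.
by apply/spellP; rewrite spell_repr spell_cat spell_repr.
Qed.

Lemma stack_spell w : stack (spell (raag_rels G) w) = foldl act [::] w.
Proof. by apply: foldl_act_pres_eq => //; apply/spellP/spell_repr. Qed.

Lemma foldl_act_pmap w s : foldl act s w = foldl (@push X) s (pmap theta_letter w).
Proof. by elim: w s => //= l w IH s; rewrite IH /act; case: (theta_letter l). Qed.

Lemma size_stack w : (size (stack (spell (raag_rels G) w)) <= size w)%N.
Proof.
rewrite stack_spell -[size w]add0n -[0%N]/(size ([::] : word X)).
elim: w [::] => [|l w IH] s /=; first by rewrite addn0.
apply: leq_trans (IH _) _; rewrite addnS -addSn leq_add2r /act.
by case: (theta_letter l) => [u|//]; apply: size_push.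
Qed.

(** A certificate of geodesicity: relabelling defines a homomorphism to a free
    group that does not increase the length, and reduced words are geodesic in
    a free group. *)
Lemma word_dist_reduced g h w u : spell (raag_rels G) w = g^-1 * h ->
  map theta_letter w = map Some u -> reduced u -> word_dist g h = size w.
Proof.
move=> we wu red; apply/eqP; rewrite eqn_leq word_dist_le //=.
have [w' w'e <-] := word_distP g h.
have -> : size w = size (stack (spell (raag_rels G) w)).
  rewrite stack_spell foldl_act_pmap.
  have -> : pmap theta_letter w = u.
    by elim: w u wu {we red} => [|l w IH] [|y u] //= [-> /IH ->].
  by rewrite push_all_reduced ?size_rev ?rev_reduced // -(size_map Some u) -wu size_map.
by rewrite we -w'e size_stack.
Qed.

End LetterMap.

Section ConsTree.
Variable L : choiceType.
Implicit Types (s t : seq L).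

Definition cons_adj s t :=
  (s != [::]) && (behead s == t) || (t != [::]) && (behead t == s).

Lemma cons_adj_sym : symmetric cons_adj.
Proof. by move=> s t; rewrite /cons_adj orbC. Qed.

Lemma cons_adj_irr : irreflexive cons_adj.
Proof.
by case=> [|l s] //; rewrite /cons_adj orbb /=; apply/negP => /eqP/(congr1 size)/= /n_Sn.
Qed.

(** Edges add or remove the first letter, so this is the rooted tree of all
    words; its subtree of reduced words is the Cayley tree of a free group.
    Using all words avoids a subtype: the extra branches change no distance. *)
Definition cons_tree : sgraph := SGraph cons_adj_sym cons_adj_irr.

Lemma cons_adjP s t : reflect (exists l, s = l :: t \/ t = l :: s) (cons_adj s t).
Proof.
apply: (iffP idP) => [/orP[]/andP[]|[l [->|->]]].
- by case: s => // l s _ /eqP <-; exists l; left.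
- by case: t => // l t _ /eqP <-; exists l; right.
- by rewrite /cons_adj /= eqxx.
- by rewrite /cons_adj /= eqxx orbT.
Qed.

Lemma cons_adj_push l s : cons_adj s (l :: s). Proof. by rewrite /cons_adj /= eqxx orbT. Qed.

(** A longest word of a cycle has a unique shorter neighbour, its tail, whereas
    its two neighbours on the cycle are not longer and have to be distinct. *)
Lemma cons_tree_is_tree : is_tree cons_tree.
Proof.
split; first by constructor; exact: ([::] : seq L).
- move=> s t.
  have up u v : exists2 p, path cons_adj v p & last v p = catrev u v.
    elim: u v => [|l u IH] v; first by exists [::].
    by have [p pp lp] := IH (l :: v); exists ((l :: v) :: p) => //=; rewrite cons_adj_push.
  have down u : exists2 p, path cons_adj u p & last u p = [::].
    elim: u => [|l u [p pp lp]]; first by exists [::].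
    by exists (u :: p) => //=; rewrite cons_adj_sym cons_adj_push.
  have [p pp lp] := down s; have [q pq lq] := up (rev t) [::].
  exists (p ++ q); first by rewrite cat_path pp lp.
  by rewrite last_cat lp lq -[catrev _ _]/(rev (rev t)) revK.
- move=> c /andP[cyc unq]; rewrite leqNgt; apply/negP => size3.
  have c0 : c != [::] by case: c size3 {cyc unq}.
  have [v vc vmax] : exists2 v, v \in c & forall u, u \in c -> (size u <= size v)%N.
    case: c c0 {cyc unq size3} => // x c _; elim: c x => [|y c IH] x.
      by exists x; rewrite ?mem_head // => u; rewrite inE => /eqP ->.
    have [v vc vmax] := IH y; case: (leqP (size v) (size x)) => vx.
      exists x; rewrite ?mem_head // => u; rewrite inE => /orP[/eqP -> //|/vmax uv].
      exact: leq_trans uv vx.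
    exists v; first by rewrite inE vc orbT.
    by move=> u; rewrite inE => /orP[/eqP ->|/vmax //]; apply: ltnW.
  have [i c' rc] := rot_to vc.
  have memc u : u \in v :: c' -> (size u <= size v)%N by rewrite -rc mem_rot => /vmax.
  move: cyc unq size3; rewrite -(rot_cycle i) -(rot_uniq i) -(size_rot i) rc.
  case/lastP: c' rc memc => [|[|y c'] x] // rc memc; rewrite /= rcons_path last_rcons.
  move=> /and3P[vy _ xv] /and3P[_ yNc' _] _.
  (* The longest word [v] is now the first of the cycle, with neighbours [y] and
     [x]. *)
  have below u : u \in v :: rcons (y :: c') x -> cons_adj v u -> u = behead v.
    move=> /memc uv /cons_adjP[l [->//|e]]; by move: uv; rewrite e /= ltnn.
  have yv : y = behead v by apply: below vy; rewrite !inE eqxx orbT.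
  have xv' : x = behead v.
    by apply: below; [rewrite inE mem_rcons mem_head orbT|rewrite cons_adj_sym].
  by case/negP: yNc'; rewrite yv -xv' mem_rcons mem_head.
Qed.

Lemma cons_tree_locally_finite : finite_set [set: L] -> locally_finite cons_tree.
Proof.
move=> finL s; apply: (@sub_finite_set _ _ ([set behead s] `|` [set l :: s | l in [set: L]])).
  move=> t /cons_adjP[l [->|->]]; first by left.
  by right; exists l.
by rewrite finite_setU; split; [exact: finite_set1|exact: finite_image].
Qed.

End ConsTree.

Lemma graph_distP (T : sgraph) (x y : T) : is_tree T ->
  exists p, [/\ path (@adj T) x p, last x p = y & size p = graph_dist x y].
Proof.
move=> [_ conn _]; have [p pp lp] := conn x y.
rewrite /graph_dist.
have [|[q /= [pq lq] <-] _] := @leastP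
  [set size p | p in [set p | path (@adj T) x p /\ last x p = y]] (size p).
  by exists p.
by exists q.
Qed.

Lemma graph_dist_le (T : sgraph) (x y : T) p : path (@adj T) x p -> last x p = y ->
  (graph_dist x y <= size p)%N.
Proof. by move=> pp lp; apply: (proj2 (@leastP _ _ _)); exists p. Qed.

Lemma graph_dist_refl (T : sgraph) (x : T) : graph_dist x x = 0%N.
Proof. by apply/eqP; rewrite -leqn0; apply: (@graph_dist_le _ _ _ [::]). Qed.

Section VertexPoint.
Local Open Scope ring_scope.
Variables (R : realType) (T : sgraph).

Lemma vertex_point_wf (v : T) : adj v v || (v == v) && (0 == 0 :> R).
Proof. by rewrite !eqxx orbT. Qed.

Definition vertex_point (v : T) : tree_point R T :=
  TreePoint (lexx 0) ler01 (vertex_point_wf v).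

Lemma path_dist_vertex (v w : T) :
  path_dist (vertex_point v) (vertex_point w) = (graph_dist v w)%:R.
Proof.
rewrite /path_dist /=; case: (eqVneq v w) => [->|vw] /=.
  by rewrite subrr normr0 graph_dist_refl.
rewrite /vertex_dist /= add0r subr0 addr0.
set d := _%:R; have -> : Num.min d (d + 1) = d by apply/min_idPl; lra.
by apply/min_idPl; lra.
Qed.
End VertexPoint.

Section Embedding.
Variables (R : realType) (G : sgraph) (n : nat) (cls : G -> 'I_n).
Hypotheses (finG : finite_set [set: G]) (clsE : forall x y, adj x y = (cls x != cls y)).
Local Notation sp := (spell (raag_rels G)).
Local Notation T := (cons_tree (G * bool)%type).

Let theta (i : 'I_n) (x : G) : option (G * bool) :=
  if cls x == i then Some (x, true) else None.

Let theta_adj i x y u v : adj x y -> theta i x = Some u -> theta i y = Some v -> u.1 = v.1.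
Proof.
rewrite clsE /theta; case: (cls x =P i) => // ->; case: (cls y =P i) => // ->.
by rewrite eqxx.
Qed.

Let theta_letterE i l :
  theta_letter (theta i) l = if cls l.1 == i then Some l else None.
Proof.
by rewrite /theta_letter /theta; case: l => x b /=; case: ifP => //= _; case: b.
Qed.

Let proj i (g : raag G) : T := stack (theta i) g.

Let value (s : word G) : raag G := sp (rev s).

Let value_cons l s : value (l :: s) = value s * sp [:: l].
Proof. by rewrite /value rev_cons -cats1 spell_cat. Qed.

Let sp_inv l : sp [:: linv l] = (sp [:: l])^-1.
Proof. by case: l => x b; rewrite -spell_winv. Qed.

Let value_push s l : value (push s l) = value s * sp [:: l].
Proof.
case: s => [|l' s] /=; first by rewrite -value_cons.
case: eqP => [->|_]; last by rewrite value_cons.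
by rewrite value_cons sp_inv mulgVK.
Qed.

Let value_act i s l :
  value (act (theta i) s l) = value s * (if cls l.1 == i then sp [:: l] else 1).
Proof. by rewrite /act theta_letterE; case: ifP => _; rewrite ?value_push ?mulg1. Qed.

Let in_class i s := all (fun l : G * bool => cls l.1 == i) s.

Let push_in_class i s l : in_class i s -> in_class i (act (theta i) s l).
Proof.
rewrite /act theta_letterE /in_class; case: ifP => // li.
case: s => [|l' s] /=; first by rewrite li.
by case: (l' =P _) => _ /andP[l'i si] //=; rewrite li l'i.
Qed.

Let foldl_in_class i w s : in_class i s -> in_class i (foldl (act (theta i)) s w).
Proof. by elim: w s => //= l w IH s si; apply/IH/push_in_class. Qed.

Let letter_commute l l' : cls l.1 != cls l'.1 -> commute (sp [:: l]) (sp [:: l']).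
Proof.
case: l l' => [x b] [y c] /=; rewrite -clsE => /gen_comm xy.
have {}xy : commute (gen x) (sp [:: (y, c)]).
  by rewrite spell_letter; case: c => //; apply: commuteV.
case: b => //; rewrite (@spell_letter _ _ x false).
exact/commute_sym/commuteV/commute_sym.
Qed.

Let value_commute i j s t : i != j -> in_class i s -> in_class j t ->
  commute (value s) (value t).
Proof.
move=> ij; elim: s => [_ _|l s IH /= /andP[/eqP li si] tj]; first exact/commute_sym/commute1.
rewrite value_cons; apply/commute_sym/commuteM/commute_sym => //.
  exact/commute_sym/IH.
move: {IH} tj; elim: t => [_|l' t IH /= /andP[/eqP l'j tj]]; first exact/commute1.
rewrite value_cons; apply: commuteM; first exact: IH.
by apply: letter_commute; rewrite li l'j.
Qed.

(** Letters of different classes commute, so each element is the product of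
    its projections to the classes. *)
Let spell_prod w : sp w = \prod_i value (foldl (act (theta i)) [::] w).
Proof.
elim/last_ind: w => [|w l IH]; first by rewrite big1.
rewrite -cats1 spell_cat IH.
under [RHS]eq_bigr => i _ do rewrite foldl_cat /= value_act.
rewrite prodgM_neq_commute ?index_enum_uniq //.
  congr (_ * _).
  rewrite (@prodg_single _ _ _ _ (cls l.1)) ?index_enum_uniq ?mem_index_enum ?eqxx //.
  by move=> i; rewrite eq_sym => /negPf ->.
move=> i j ij; case: eqP => [lj|_]; last exact: commute1.
rewrite -[sp [:: l]]/(value [:: l]); apply: (@value_commute i j) => //.
  by apply: foldl_in_class.
by rewrite /= lj eqxx.
Qed.

Let proj_mul i g w : proj i (g * sp w) = foldl (act (theta i)) (proj i g) w.
Proof. by rewrite /proj stack_mul //; apply: theta_adj. Qed.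

Let raag_prod g : g = \prod_i value (proj i g).
Proof. by rewrite -[LHS](spell_repr g) spell_prod. Qed.

Let push_path s l : exists p, [/\ path (@adj T) s p, last s p = push s l & size p = 1%N].
Proof.
case: s => [|l' s] /=; first by exists [:: [:: l]].
case: eqP => _; last by exists [:: [:: l, l' & s]]; rewrite /= cons_adj_push.
by exists [:: s]; rewrite /= cons_adj_sym cons_adj_push.
Qed.

Let proj_dist_le i s w : (@graph_dist T s (foldl (act (theta i)) s w)
  <= count (fun l => cls l.1 == i) w)%N.
Proof.
suff [p [pp lp <-]] : exists p, [/\ path (@adj T) s p, last s p = foldl (act (theta i)) s w
    & size p = count (fun l => cls l.1 == i) w] by apply: graph_dist_le lp.
elim: w s => [|l w IH] s; first by exists [::].
rewrite /= {2}/act theta_letterE; case: ifP => _; last exact: IH.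
have [p [pp lp sp]] := push_path s l; have [q [pq lq sq]] := IH (push s l).
by exists (p ++ q); rewrite cat_path pp lp last_cat lp size_cat sp sq.
Qed.

(** No reducedness is needed along the path: each edge multiplies the value of a
    word by one letter, whether or not this letter cancels. *)
Let path_word s p : path (@adj T) s p ->
  exists2 w, size w = size p & value (last s p) = value s * sp w.
Proof.
elim: p s => [|t p IH] s /=; first by exists [::]; rewrite ?spell_nil ?mulg1.
move=> /andP[/cons_adjP[l st] /IH[w sw vw]].
case: st => e.
  exists (linv l :: w); rewrite /= ?sw // vw e spell_cons sp_inv value_cons mulgA.
  by rewrite mulgK.
by exists (l :: w); rewrite /= ?sw // vw e spell_cons value_cons mulgA.
Qed.

Let sum_count (w : word G) : (\sum_i count (fun l => cls l.1 == i) w = size w)%N.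
Proof.
elim: w => [|l w IH] /=; first by rewrite big1.
rewrite big_split IH /= (bigD1 (cls l.1)) //= eqxx big1 // => i.
by rewrite eq_sym => /negPf ->.
Qed.

(** A word from [g] to [h] moves the coordinates along paths whose lengths add
    up to its own.  Conversely, geodesics in the trees give words [w i], and
    concatenating these gives a word from [g] to [h], by commutation. *)
Let word_dist_sum g h : word_dist g h = (\sum_i graph_dist (proj i g) (proj i h))%N.
Proof.
apply/eqP; rewrite eqn_leq; apply/andP; split; last first.
  have [w we <-] := word_distP g h; rewrite -sum_count; apply: leq_sum => i _.
  by rewrite -[h](mulVKg g) -we proj_mul; apply: proj_dist_le.
have /choice[w wP] : forall i, exists w, size w = graph_dist (proj i g) (proj i h) /\
    value (proj i h) = value (proj i g) * sp w.
  move=> i; have [p [pp lp <-]] := graph_distP (proj i g) (proj i h) (cons_tree_is_tree _).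
  by have [w sw] := path_word pp; rewrite lp => vw; exists w.
have catE (r : seq 'I_n) : exists2 u, sp u = \prod_(i <- r) sp (w i)
    & size u = (\sum_(i <- r) graph_dist (proj i g) (proj i h))%N.
  elim: r => [|i r [u uE su]]; first by exists [::]; rewrite ?big_nil.
  exists (w i ++ u); first by rewrite big_cons spell_cat uE.
  by rewrite big_cons size_cat su (wP i).1.
have [u uE <-] := catE (index_enum 'I_n); apply: word_dist_le.
rewrite uE [X in _ = _^-1 * X]raag_prod; under [in RHS]eq_bigr do rewrite (wP _).2.
rewrite prodgM_neq_commute ?index_enum_uniq // -?raag_prod ?mulKg //.
have classi i g' : in_class i (proj i g') by apply: foldl_in_class.
move=> i j ij; have -> : sp (w j) = (value (proj j g))^-1 * value (proj j h).
  by rewrite (wP j).2 mulKg.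
by apply: commuteM; [apply: commuteV|]; apply: (@value_commute i j).
Qed.

Lemma classes_embed : embeds_in_product_of_lf_trees R G.
Proof.
exists n, (fun=> T), (fun g i => vertex_point R (proj i g)); split=> [i|g h].
  split; [exact: cons_tree_is_tree|apply: cons_tree_locally_finite].
  by rewrite -setXTT; apply: finite_setX => //; apply: finite_finset.
rewrite /l1_dist word_dist_sum natr_sum; apply: eq_bigr => i _.
exact: path_dist_vertex.
Qed.
End Embedding.

(** * The metric of a tree *)

Section CommonPrefix.
Variable X : eqType.
Implicit Types (s t u : seq X).

Fixpoint lcp s t : nat :=
  match s, t with
  | x :: s', y :: t' => if x == y then (lcp s' t').+1 else 0
  | _, _ => 0
  end.

(** Turns comparisons with [lcp] into equalities of prefixes, which is how
    ultrametricity and all later uses are proved. *)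
Lemma leq_lcp n s t :
  (n <= lcp s t)%N = [&& (n <= size s)%N, (n <= size t)%N & take n s == take n t].
Proof.
elim: n s t => [|n IH] [|x s] [|y t] //=.
  by rewrite andbF.
rewrite eqseq_cons !ltnS; case: eqP => _; first by rewrite ltnS IH.
by rewrite !andbF.
Qed.

Lemma lcpC : commutative lcp.
Proof. by elim=> [|x s IH] [|y t] //=; rewrite eq_sym IH. Qed.

Lemma lcp_sizel s t : (lcp s t <= size s)%N.
Proof. by have := leqnn (lcp s t); rewrite {1}leq_lcp => /and3P[]. Qed.

Lemma lcp_refl s : lcp s s = size s.
Proof. by elim: s => //= x s ->; rewrite eqxx. Qed.

Lemma lcp_ultra s t u : (minn (lcp s t) (lcp t u) <= lcp s u)%N.
Proof.
set n := minn _ _; rewrite leq_lcp.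
have : (n <= lcp s t)%N := geq_minl _ _; have : (n <= lcp t u)%N := geq_minr _ _.
by rewrite !leq_lcp => /and3P[_ -> /eqP <-] /and3P[-> _ /eqP ->] /=.
Qed.

(** Passing from a vertex to a child changes the common prefix with a fixed
    vertex only if that vertex lies below the child. *)
Lemma lcp_rcons s t x : lcp (rcons s x) t = lcp s t \/
  lcp (rcons s x) t = (size s).+1 /\ lcp s t = size s.
Proof.
elim: s t => [|y s IH] [|z t] /=; [by left| |by left|].
  by case: eqP => _; [right; case: t|left].
by case: eqP => _; [|by left]; case: (IH t) => [->|[-> ->]]; [left|right].
Qed.

End CommonPrefix.

Section RootedTree.
Variables (T : sgraph) (treeT : is_tree T) (r : T).
Local Notation path := (path (@adj T)).

(** At the first place where two simple paths diverge they enclose a cycle. *)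
Lemma tree_path_unique (x : T) p q : path x p -> path x q ->
  uniq (x :: p) -> uniq (x :: q) -> last x p = last x q -> p = q.
Proof.
elim: p x q => [|y p IH] x [|z q] //=.
- by move=> _ _ _ /andP[xq _] e; move: xq; rewrite {1}e mem_last.
- by move=> _ _ /andP[xp _] _ e; move: xp; rewrite -{1}e mem_last.
move=> /andP[xy pp] /andP[xz pq] /andP[xp up] /andP[xq uq] e.
case: (eqVneq y z) => [yz|yz].
  by subst z; congr (_ :: _); apply: (IH y).
(* From [y] to [z] through the common end point; this avoids [x]. *)
exfalso; pose w := p ++ rev (belast z q).
have pw : path y w.
  rewrite cat_path pp e rev_path.
  by rewrite (eq_path (e' := @adj T)) // => a b; rewrite adj_sym.
have lw : last y w = z.
  rewrite last_cat e; case: (q) => [|a q'] //=.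
  by rewrite rev_cons last_rcons.
have xw : x \notin y :: w.
  rewrite inE mem_cat negb_or negb_or; move: xp; rewrite inE negb_or => /andP[-> ->] /=.
  by apply: contra xq; rewrite mem_rev => /mem_belast.
case/shortenP: pw lw => w' pw' uw' sub lw'.
have : (size [:: x, y & w'] <= 2)%N.
  have [_ _] := treeT; apply; apply/andP; split; last first.
    rewrite /= in uw' *; rewrite uw' andbT; apply: contra xw.
    by rewrite !inE => /orP[->//|/sub ->]; rewrite orbT.
  by rewrite /= rcons_path lw' xy pw' adj_sym xz.
case: w' lw' {pw' uw' sub} => //= yz'; by rewrite yz' eqxx in yz.
Qed.

Lemma anc_exists (v : T) : exists p, [/\ path r p, last r p = v & uniq (r :: p)].
Proof.
have [_ conn _] := treeT; have [p pp lp] := conn r v.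
by case/shortenP: pp lp => p' pp' up' _ lp'; exists p'.
Qed.

(** The path from the root identifies each vertex with the list of its
    ancestors, which turns the geometry of the tree into that of common
    prefixes.  The root is not listed, so that the length is the depth. *)
Definition anc (v : T) : seq T := sval (cid (anc_exists v)).

Lemma ancP v : [/\ path r (anc v), last r (anc v) = v & uniq (r :: anc v)].
Proof. exact: svalP (cid (anc_exists v)). Qed.

Lemma anc_unique v p : path r p -> last r p = v -> uniq (r :: p) -> anc v = p.
Proof.
move=> pp lp up; have [pa la ua] := ancP v.
by apply: (@tree_path_unique r) => //; rewrite la lp.
Qed.

Lemma anc_adj u v : adj u v -> anc v = rcons (anc u) v \/ anc u = rcons (anc v) u.
Proof.
move=> uv; have [pu lu uu] := ancP u.
case: (boolP (v \in r :: anc u)) => [vu|vu]; last first.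
  left; apply: anc_unique; rewrite ?rcons_path ?pu ?lu ?last_rcons //.
  by rewrite -rcons_cons rcons_uniq vu.
right; move: pu lu uu; case/splitPl: vu => p1 p2 l1.
rewrite cat_path l1 last_cat l1 -cat_cons cat_uniq => /andP[pp1 pp2] lp2 /and3P[u1 d12 u2].
rewrite (anc_unique pp1 l1 u1) -cats1; congr (_ ++ _).
apply: (@tree_path_unique v) => //=; rewrite ?andbT ?inE.
- by rewrite adj_sym.
- rewrite u2 andbT; apply/negP => vp2; case/negP: d12; apply/hasP; exists v => //.
  by rewrite -l1 mem_last.
- by apply: contraTneq uv => ->; rewrite adj_irr.
Qed.

Definition depth (v : T) : nat := size (anc v).
Definition meet_depth (u v : T) : nat := lcp (anc u) (anc v).

Lemma anc_inj : injective anc.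
Proof. by move=> u v e; have [_ <- _] := ancP u; have [_ <- _] := ancP v; rewrite e. Qed.

(** Going through the last common ancestor gives one inequality.  For the other
    one, follow an arbitrary path: each edge changes the difference of the two
    sides by at most one. *)
Lemma graph_dist_meet u v : (graph_dist u v + (meet_depth u v).*2 = depth u + depth v)%N.
Proof.
apply/eqP; rewrite eqn_leq; apply/andP; split.
  set n := meet_depth u v.
  have := leqnn n; rewrite {2}/n leq_lcp => /and3P[nu nv /eqP uv].
  have [pu lu _] := ancP u; have [pv lv _] := ancP v.
  rewrite -(cat_take_drop n (anc u)) cat_path last_cat in pu lu.
  rewrite -(cat_take_drop n (anc v)) cat_path last_cat -uv in pv lv.
  set a := last r _ in pu lu pv lv.
  have /andP[_ pu'] := pu; have /andP[_ pv'] := pv.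
  have : (graph_dist u v <= size (drop n (anc u)) + size (drop n (anc v)))%N.
    rewrite -[X in (_ <= X + _)%N](size_belast a) -size_rev -size_cat.
    apply: graph_dist_le.
      rewrite cat_path -{1}lu rev_path (eq_path (e' := @adj T)); last first.
        by move=> b c; rewrite adj_sym.
      rewrite pu' /=.
      suff -> : last u (rev (belast a (drop n (anc u)))) = a by [].
      by case: (drop n (anc u)) lu => [|b s] //= _; rewrite rev_cons last_rcons.
    rewrite last_cat.
    suff -> : last u (rev (belast a (drop n (anc u)))) = a by [].
    by case: (drop n (anc u)) lu => [|b s] //= _; rewrite rev_cons last_rcons.
  rewrite !size_drop /depth; move: nu nv; clearbody n.
  move: (graph_dist u v) (size (anc u)) (size (anc v)) => d h k; clear; lia.
have [p [pp lp <-]] := graph_distP u v treeT.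
elim: p u pp lp => [|w p IH] u /=.
  by move=> _ ->; rewrite /meet_depth lcp_refl /depth addnn.
move=> /andP[uw pw] lw; have := IH w pw lw.
case: (anc_adj uw) => e.
  have : (meet_depth w v <= (meet_depth u v).+1)%N /\ depth w = (depth u).+1.
    rewrite /meet_depth /depth e size_rcons; split=> //.
    by case: (lcp_rcons (anc u) (anc v) w) => [->|[-> ->]].
  move: (meet_depth w v) (meet_depth u v) (depth u) (depth v) (depth w) (size p).
  by clear; lia.
have : (meet_depth w v <= meet_depth u v)%N /\ depth u = (depth w).+1.
  rewrite /meet_depth /depth e size_rcons; split=> //.
  by case: (lcp_rcons (anc w) (anc v) u) => [->|[-> ->]].
move: (meet_depth w v) (meet_depth u v) (depth u) (depth v) (depth w) (size p).
by clear; lia.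
Qed.

Section Points.
Local Open Scope ring_scope.
Variable R : realType.
Implicit Types (p q : tree_point R T) (u v c : T).

(** The end farther from the root of the edge that carries the point. *)
Definition child p : T := if (depth (src p) <= depth (tgt p))%N then tgt p else src p.
(** The distance to the root; interpolating between the end points covers both
    orientations of the edge at once. *)
Definition height p : R := (1 - pos p) * (depth (src p))%:R + pos p * (depth (tgt p))%:R.
(** The Gromov product at the root: the height at which the paths from the
    root to [p] and to [q] separate. *)
Definition gromov p q : R :=
  Num.min (Num.min (height p) (height q)) (meet_depth (child p) (child q))%:R.

Lemma gromovC p q : gromov p q = gromov q p.
Proof. by rewrite /gromov /meet_depth lcpC [Num.min (height p) _]minC. Qed.

Lemma gromov_lel p q : gromov p q <= height p.
Proof. by rewrite /gromov !ge_min lexx. Qed.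

(** The triangle inequality and the four point condition follow from this
    ultrametric inequality, which common prefixes satisfy. *)
Lemma gromov_ultra p q s : Num.min (gromov p q) (gromov q s) <= gromov p s.
Proof.
have : Num.min (meet_depth (child p) (child q))%:R (meet_depth (child q) (child s))%:R
   <= (meet_depth (child p) (child s))%:R :> R.
  by rewrite -natr_min ler_nat /meet_depth; apply: lcp_ultra.
rewrite /gromov; move: (_ (child p) (child q))%:R (_ (child q) (child s))%:R.
move: (_ (child p) (child s))%:R => z.
move: (height p) (height q) (height s) => a b c x y.
rewrite !le_min !ge_min => H.
by repeat match goal with |- context [Num.min ?a ?b] => case: (leP a b) => ? end; lra.
Qed.

(** The three kinds of codes of a point: a vertex, or a point of an edge from
    [u] down to its child [c], oriented in either way.  The indices are the
    values of [child] and [height]. *)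
Inductive point_spec p : T -> R -> Prop :=
| VertexPoint : src p = tgt p -> pos p = 0 -> point_spec p (src p) (depth (src p))%:R
| UpPoint u c y : anc c = rcons (anc u) c -> 0 <= y <= 1 ->
    src p = u -> tgt p = c -> pos p = y -> point_spec p c ((depth u)%:R + y)
| DownPoint u c y : anc c = rcons (anc u) c -> 0 <= y <= 1 ->
    src p = c -> tgt p = u -> pos p = 1 - y -> point_spec p c ((depth u)%:R + y).

Lemma pointP p : point_spec p (child p) (height p).
Proof.
have := pos_ge0 p; have := pos_le1 p; have := point_wf p.
case/orP=> [st|/andP[/eqP st /eqP p0]] le1 ge0; last first.
  rewrite /child -st leqnn /height -st p0 subr0 mul1r mul0r addr0.
  exact: VertexPoint.
case: (anc_adj st) => e.
  have ds : depth (tgt p) = (depth (src p)).+1 by rewrite /depth e size_rcons.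
  rewrite /child /height ds leqnSn.
  have -> : (1 - pos p) * (depth (src p))%:R + pos p * (depth (src p)).+1%:R =
     (depth (src p))%:R + pos p by rewrite -natr1; ring.
  by apply: UpPoint => //; rewrite le1 ge0.
have ds : depth (src p) = (depth (tgt p)).+1 by rewrite /depth e size_rcons.
rewrite /child /height ds ltnn.
have -> : (1 - pos p) * (depth (tgt p)).+1%:R + pos p * (depth (tgt p))%:R =
   (depth (tgt p))%:R + (1 - pos p) by rewrite -natr1; ring.
by apply: DownPoint => //; [apply/andP; split; lra|lra].
Qed.

Lemma meet_depthC u v : meet_depth u v = meet_depth v u.
Proof. exact: lcpC. Qed.

Lemma meet_depth_child c u v : anc c = rcons (anc u) c ->
  (meet_depth c v = meet_depth u v /\ (meet_depth u v <= depth u)%N) \/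
  (meet_depth c v = (depth u).+1 /\ meet_depth u v = depth u).
Proof.
rewrite /meet_depth /depth => ->; have := lcp_sizel (anc u) (anc v).
by case: (lcp_rcons (anc u) (anc v) c); [left|right].
Qed.

Lemma depth_child c u : anc c = rcons (anc u) c -> depth c = (depth u).+1.
Proof. by rewrite /depth => ->; rewrite size_rcons. Qed.

Lemma graph_dist_meetR u v : (graph_dist u v)%:R =
  (depth u)%:R + (depth v)%:R - 2 * (meet_depth u v)%:R :> R.
Proof.
by rewrite -natrD -graph_dist_meet natrD -muln2 natrM; ring.
Qed.

Ltac min_lra :=
  repeat match goal with |- context [Order.min ?a ?b] =>
    lazymatch a with context [Order.min _ _] => fail | _ => idtac end;
    lazymatch b with context [Order.min _ _] => fail | _ => idtac end;
    case: (leP a b) => ?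
  end; lra.

Lemma height_le_depth p : height p <= (depth (child p))%:R.
Proof.
case: (pointP p) => [//|u c y e|u c y e]; rewrite (depth_child e) -natr1 => /andP[? ?] _ _ _.
  lra.
lra.
Qed.

Lemma height_ge0 p : 0 <= height p.
Proof.
case: (pointP p) => [//|u c y e|u c y e] /andP[? ?] _ _ _.
  exact: addr_ge0.
exact: addr_ge0.
Qed.

Lemma vertex_dist_meet v q : vertex_dist v q =
  (depth v)%:R + height q - 2 * Num.min (height q) (meet_depth v (child q))%:R.
Proof.
rewrite /vertex_dist !graph_dist_meetR; case: (pointP q) => [e p0|u c y e|u c y e].
- have : (meet_depth v (src q))%:R <= (depth (src q))%:R :> R.
    by rewrite ler_nat meet_depthC lcp_sizel.
  by rewrite -e p0 subr0 addr0 => ?; min_lra.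
- move=> /andP[y0 y1] -> -> ->; rewrite (depth_child e) -!natr1 ![meet_depth v _]meet_depthC.
  case: (meet_depth_child v e) => [[-> ]|[-> ->]]; rewrite -?(ler_nat R) -?natr1 => *; min_lra.
- move=> /andP[y0 y1] -> -> ->; rewrite (depth_child e) -!natr1 ![meet_depth v _]meet_depthC.
  case: (meet_depth_child v e) => [[-> ]|[-> ->]]; rewrite -?(ler_nat R) -?natr1 => *; min_lra.
Qed.

(** If the lower end of the edge of [q] is a strict descendant of [c], then its
    upper end is still a descendant of [c], so all of the edge is below [c]. *)
Lemma descendant_height c u q : anc c = rcons (anc u) c -> meet_depth c (child q) = depth c ->
  (depth c)%:R <= height q \/
  child q = c /\ (src q = u /\ tgt q = c \/ src q = c /\ tgt q = u).
Proof.
move=> e.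
have parent c' u' u'' : anc c' = rcons (anc u') c' -> anc c' = rcons (anc u'') c' -> u' = u''.
  by move=> -> /rcons_inj[] /anc_inj.
have strict c' u' : anc c' = rcons (anc u') c' -> c' != c -> meet_depth c c' = depth c ->
    (depth c <= depth u')%N.
  move=> e' c'c mc; rewrite -ltnS -(depth_child e') ltn_neqAle; apply/andP; split.
    apply: contra_neq c'c => dd; apply: anc_inj.
    have : (depth c <= meet_depth c c')%N by rewrite mc.
    rewrite leq_lcp => /and3P[_ _].
    by rewrite {2}dd !take_size => /eqP.
  by rewrite -mc meet_depthC; apply: lcp_sizel.
case: (pointP q) => [_ _ mc|u' c' y e' /andP[y0 y1] s t _ mc|u' c' y e' /andP[y0 y1] s t _ mc].
- by left; rewrite ler_nat -mc meet_depthC; apply: lcp_sizel.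
- case: (eqVneq c' c) => [cc|/(strict _ _ e')/(_ mc)]; last first.
    by rewrite -(ler_nat R); left; lra.
  right; split=> //; left; rewrite s t cc; split=> //.
  by apply: (parent c); rewrite -?cc // cc.
- case: (eqVneq c' c) => [cc|/(strict _ _ e')/(_ mc)]; last first.
    by rewrite -(ler_nat R); left; lra.
  right; split=> //; right; rewrite s t cc; split=> //.
  by apply: (parent c); rewrite -?cc // cc.
Qed.

(** If [q] branches off above [c], then paths to it leave through [u];
    otherwise [q] lies below [c] and they leave through [c]. *)
Lemma far_dist c u y q : anc c = rcons (anc u) c -> 0 <= y <= 1 ->
  ~~ ((src q == u) && (tgt q == c)) -> ~~ ((src q == c) && (tgt q == u)) ->
  Num.min (y + vertex_dist u q) (1 - y + vertex_dist c q) =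
  (depth u)%:R + y + height q -
    2 * Num.min (Num.min ((depth u)%:R + y) (height q)) (meet_depth c (child q))%:R.
Proof.
move=> e /andP[y0 y1] nuc ncu; rewrite !vertex_dist_meet (depth_child e) -[(depth u).+1%:R]natr1.
case: (meet_depth_child (child q) e) => [[-> ]|[mc ->]].
  by rewrite -(ler_nat R) => ?; min_lra.
have : (depth c)%:R <= height q.
  have mc' : meet_depth c (child q) = depth c by rewrite mc (depth_child e).
  case: (descendant_height e mc') => // -[_ [] [s t]].
    by rewrite s t !eqxx in nuc.
  by rewrite s t !eqxx in ncu.
by rewrite mc (depth_child e) -[(depth u).+1%:R]natr1 => ?; min_lra.
Qed.

Lemma min_height (a b d : R) : a <= d -> b <= d ->
  a + b - 2 * Num.min (Num.min a b) d = `|a - b|.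
Proof.
move=> ad bd; have [ab|ab] := leP a b.
  by rewrite distrC ger0_norm; min_lra.
by rewrite gtr0_norm; min_lra.
Qed.

Lemma depth_adj u v : adj u v -> depth v = (depth u).+1 \/ depth u = (depth v).+1.
Proof. by move/anc_adj=> [/depth_child|/depth_child]; [left|right]. Qed.

(** The three clauses in the definition of [path_dist] are a single formula. *)
Lemma path_dist_gromov p q : path_dist p q = height p + height q - 2 * gromov p q.
Proof.
have same_child : child p = child q ->
    height p + height q - 2 * gromov p q = `|height p - height q|.
  move=> pq; rewrite /gromov pq {1}/meet_depth lcp_refl; apply: min_height.
    by rewrite -pq; apply: height_le_depth.
  exact: height_le_depth.
rewrite /path_dist; case: ifPn => [/andP[/eqP s /eqP t]|nst].
  rewrite same_child; last by rewrite /child s t.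
  case/orP: (point_wf p) => [/depth_adj|/andP[/eqP st /eqP p0]].
    rewrite /height s t; case=> ->; rewrite -natr1; last rewrite -normrN.
      by congr `|_|; ring.
    by congr `|_|; ring.
  case/orP: (point_wf q) => [|/andP[_ /eqP q0]]; first by rewrite -s -t st adj_irr.
  by rewrite /height s t p0 q0 !subrr.
case: ifPn => [/andP[/eqP s /eqP t]|nts].
  case/orP: (point_wf p) => [/depth_adj|/andP[/eqP st _]]; last first.
    by move: nst; rewrite -s -t st !eqxx.
  move=> d; rewrite same_child; last first.
    by rewrite /child s t; case: d; rewrite s t => ->; rewrite leqnSn ltnn.
  move: d; rewrite /height s t; case=> ->; rewrite -natr1; last rewrite -normrN.
    by congr `|_|; ring.
  by congr `|_|; ring.
move: nst nts; rewrite ![src p == _]eq_sym ![tgt p == _]eq_sym /gromov.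
case: (pointP p) => [e p0|u c y e y01 -> -> ->|u c y e y01 -> -> ->] n1 n2.
- rewrite -e p0 subr0 add0r vertex_dist_meet.
  have := height_ge0 q; have : (meet_depth (src p) (child q))%:R <= (depth (src p))%:R :> R.
    by rewrite ler_nat lcp_sizel.
  by move=> *; min_lra.
- by apply: far_dist => //; rewrite andbC.
- rewrite minC; have -> : 1 - (1 - y) = y by ring.
  by apply: far_dist => //; rewrite andbC.
Qed.

Lemma path_dist_ge0 p q : 0 <= path_dist p q.
Proof.
rewrite path_dist_gromov; have := gromov_lel p q; have := gromov_lel q p.
by rewrite [gromov q p]gromovC; lra.
Qed.

Lemma path_dist_refl p : path_dist p p = 0.
Proof. by rewrite /path_dist !eqxx subrr normr0. Qed.

Lemma path_dist_sym p q : path_dist p q = path_dist q p.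
Proof. by rewrite !path_dist_gromov gromovC; ring. Qed.

Lemma path_dist_triangle q p s : path_dist p s <= path_dist p q + path_dist q s.
Proof.
rewrite !path_dist_gromov; have := gromov_ultra p q s.
have := gromov_lel q p; have := gromov_lel q s; rewrite [gromov q p]gromovC.
by move: (gromov p q) (gromov q s) (gromov p s) => x y z; case: (leP x y); lra.
Qed.

(** Trees are 0-hyperbolic; in terms of Gromov products, this follows from four
    instances of the ultrametric inequality. *)
Lemma path_dist_four_point p q s t :
  path_dist p s + path_dist q t <=
  Num.max (path_dist p q + path_dist s t) (path_dist q s + path_dist p t).
Proof.
rewrite !path_dist_gromov.
have := gromov_ultra p q s; have := gromov_ultra p t s.
have := gromov_ultra q s t; have := gromov_ultra q p t.
rewrite [gromov q p]gromovC [gromov t s]gromovC.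
move: (gromov p q) (gromov s t) (gromov q s) (gromov p t) (gromov p s) (gromov q t) => a b c d e f.
move: (height p) (height q) (height s) (height t) => hp hq hs ht.
case: (leP a d) => ?; case: (leP c b) => ?; case: (leP d b) => ?; case: (leP a c) => ?.
all: by move=> *; rewrite le_max; apply/orP; first [left; lra|right; lra].
Qed.

(** As the root is not listed, the entry [n] of [anc u] is the ancestor at depth
    [n + 1]. *)
Lemma next_anc_adj (n : nat) u v : (n <= meet_depth u v)%N -> (n < depth u)%N ->
  adj (last r (take n (anc v))) (nth r (anc u) n).
Proof.
rewrite leq_lcp => /and3P[_ _ /eqP <-] nu.
have [+ _ _] := ancP u.
rewrite -{1}(cat_take_drop n (anc u)) cat_path (drop_nth r nu) /=.
by move=> /and3P[].
Qed.

(** At most one member of the family can branch off above [p] (the set [A]): two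
    of them would be joined by a path that misses [p].  The others lie below [p]
    (the set [B]) and pairwise separate exactly at [p].  So their ancestors at
    depth [n + 1], where [n] is the integral part of the height of [p], are
    distinct; and these are neighbours of the ancestor of [p] at depth [n]. *)
Lemma rooted_star_finite (I : Type) (y : I -> tree_point R T) p : locally_finite T ->
  (forall i j, i <> j -> path_dist (y i) (y j) = path_dist (y i) p + path_dist p (y j)) ->
  finite_set [set i | path_dist (y i) p != 0].
Proof.
move=> lfT star.
have starM i j : i <> j -> gromov (y i) p + gromov (y j) p = height p + gromov (y i) (y j).
  move=> /star; rewrite !path_dist_gromov [gromov p _]gromovC; lra.
pose A := [set i | gromov (y i) p < height p].
pose B := [set i | height p <= gromov (y i) p /\ height p < height (y i)].
apply: (@sub_finite_set _ _ (A `|` B)) => [i /=|].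
  rewrite path_dist_gromov => d0.
  case: (ltP (gromov (y i) p) (height p)) => mi; [by left|right; split=> //].
  rewrite lt_neqAle; apply/andP; split.
    apply: contra d0 => /eqP hi; apply/eqP.
    by have := gromov_lel (y i) p; lra.
  exact: le_trans mi (gromov_lel _ _).
rewrite finite_setU; split.
  have subA i j : A i -> A j -> i = j.
    rewrite /A /= => Ai Aj; apply: contrapT => /starM ij.
    have := gromov_ultra (y i) p (y j); rewrite [gromov p _]gromovC.
    by case: (leP (gromov (y i) p) (gromov (y j) p)) => *; lra.
  have [[i Ai]|noA] := pselect (exists i, A i).
    by apply: (@sub_finite_set _ _ [set i]) => [j Aj|]; [exact: subA|exact: finite_set1].
  by apply: (@sub_finite_set _ _ set0) => [j Aj|]; [case: noA; exists j|exact: finite_set0].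
pose n := Num.truncn (height p).
have /andP[np pn] : n%:R <= height p < n.+1%:R by apply/truncn_itv/height_ge0.
pose w i := nth r (anc (child (y i))) n.
have Bdepth i : B i -> (n < depth (child (y i)))%N.
  move=> [_ hi]; rewrite -(ltr_nat R); apply: le_lt_trans np (lt_le_trans hi _).
  exact: height_le_depth.
have Bmeet i : B i -> (n <= meet_depth (child (y i)) (child p))%N.
  move=> [mi _]; rewrite -(ler_nat R); apply: le_trans np (le_trans mi _).
  by rewrite /gromov ge_min lexx orbT.
have winj : {in B &, injective w}.
  move=> i j /set_mem Bi /set_mem Bj wij; apply: contrapT => /starM.
  have := gromov_lel p (y i); have := gromov_lel p (y j).
  rewrite ![gromov p _]gromovC.
  have : (n < meet_depth (child (y i)) (child (y j)))%N.
    rewrite leq_lcp !Bdepth //= !(take_nth r) ?Bdepth // -!/(w _) wij.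
    rewrite eqseq_rcons eqxx andbT.
    have := Bmeet i Bi; have := Bmeet j Bj; rewrite !leq_lcp.
    by move=> /and3P[_ _ /eqP ->] /and3P[_ _ /eqP ->].
  rewrite -(ler_nat R) => h.
  have : height p < gromov (y i) (y j).
    rewrite /gromov !lt_min (proj2 Bi) (proj2 Bj) /=.
    exact: lt_le_trans pn h.
  by case: Bi Bj => [? _] [? _]; lra.
rewrite -(eq_finite_set (inj_card_eq winj)).
apply: sub_finite_set (lfT (last r (take n (anc (child p))))) => _ [i Bi <-] /=.
by apply: next_anc_adj; [exact: Bmeet|exact: Bdepth].
Qed.
End Points.
End RootedTree.

Section TreeMetric.
Local Open Scope ring_scope.
Variables (R : realType) (T : sgraph) (treeT : is_tree T).
Implicit Types p q s t : tree_point R T.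

Lemma star_finite (I : Type) (y : I -> tree_point R T) p : locally_finite T ->
  (forall i j, i <> j -> path_dist (y i) (y j) = path_dist (y i) p + path_dist p (y j)) ->
  finite_set [set i | path_dist (y i) p != 0].
Proof. by have [[r] _ _] := treeT; apply: rooted_star_finite. Qed.

End TreeMetric.

(** * Graphs of groups embedded in products of locally finite trees *)

Section GeodesicWords.
Variables (G : sgraph).
Local Notation sp := (spell (raag_rels G)).

Lemma spell_nseqV x p : sp (nseq p (x, false)) = (sp (nseq p (x, true)))^-1.
Proof. by rewrite -spell_winv /winv map_nseq rev_nseq. Qed.

Lemma path_run (X : eqType) (e : rel X) x y z s n :
  e x y -> e y y -> e y z -> e x z -> path e z s -> path e x (nseq n y ++ z :: s).
Proof.
by move=> + yy yz + zs; elim: n x => [|n IH] x /= xy xz; rewrite ?xz ?xy //=; apply: IH.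
Qed.

Lemma path_nseq (X : eqType) (e : rel X) x y n : e x y -> e y y -> path e x (nseq n y).
Proof. by move=> + yy; elim: n x => //= n IH x ->; apply: IH. Qed.

Lemma noncancel_same (l : G * bool) : noncancel l l.
Proof. by case: l => x []; rewrite /noncancel xpair_eqE andbF. Qed.

Lemma noncancel_neq (x y : G) e e' : x != y -> noncancel (x, e) (y, e').
Proof. by move=> xy; rewrite /noncancel xpair_eqE /= eq_sym (negPf xy). Qed.

(** Relabelling both letters by the same letter, with signs, leaves no
    cancellation, whether or not [x] and [y] commute. *)
Lemma two_runs_geodesic (g : raag G) x y e e' n m : x != y ->
  word_dist g (g * sp (nseq n (x, e) ++ nseq m (y, e'))) = (n + m)%N.
Proof.
move=> xy.
pose theta z := if z == x then Some (x, e) else if z == y then Some (x, e') else None.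
have theta1 z u : theta z = Some u -> u.1 = x.
  by rewrite /theta; case: ifP => [_ [<-]//|_]; case: ifP => // _ [<-].
rewrite (@word_dist_reduced _ _ theta _ _ _ (nseq n (x, e) ++ nseq m (y, e'))
  (nseq (n + m) (x, true))).
- by rewrite size_cat !size_nseq.
- by move=> z z' u v _ /theta1 -> /theta1 ->.
- by rewrite mulKg.
- rewrite map_cat !map_nseq nseqD /theta_letter /theta /= !eqxx [y == x]eq_sym (negPf xy) /=.
  by rewrite !eqxx.
- by rewrite /reduced; case: (n + m)%N => //= p; apply: path_nseq; apply: noncancel_same.
Qed.

(** Relabelling [b] by [a] keeps the relations, because neither commutes with
    [c], and turns the word into a reduced word in the two letters [a], [c]. *)
Lemma branch_geodesic (g : raag G) a b c x p l q :
  ~~ adj a c -> ~~ adj b c -> a != c -> b != c -> x \in [:: a; b] ->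
  word_dist g (g * sp (nseq p (x, false) ++ (c, false) :: nseq l.+1 (a, true) ++
                       (c, true) :: nseq q (x, true))) = (p + l + q + 3)%N.
Proof.
move=> ac bc aNc bNc xab.
pose theta z :=
  if z \in [:: a; b] then Some (a, true) else if z == c then Some (c, true) else None.
have cab : c \in [:: a; b] = false by rewrite !inE ![c == _]eq_sym (negPf aNc) (negPf bNc).
pose w z := nseq p (z, false) ++ (c, false) :: nseq l.+1 (a, true) ++ (c, true) :: nseq q (z, true).
rewrite (@word_dist_reduced _ _ theta _ _ _ (w x) (w a)) /w.
- by rewrite size_cat /= size_cat /= !size_nseq; lia.
- have nadj z : z \in [:: a; b] -> ~~ adj z c by rewrite !inE => /orP[] /eqP ->.
  move=> z z' u v; rewrite /theta.
  case: (boolP (z \in [:: a; b])) => zab; case: (boolP (z' \in [:: a; b])) => z'ab.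
  + by move=> _ [<-] [<-].
  + by case: (z' =P c) => [->|_ _ _ //] zc; move: (nadj _ zab); rewrite zc.
  + by case: (z =P c) => [->|_ _ //] zc; move: (nadj _ z'ab); rewrite adj_sym zc.
  + case: (z =P c) => [_|_ _ //]; case: (z' =P c) => [_|_ _ _ //].
    by move=> _ [<-] [<-].
- by rewrite mulKg.
- rewrite !map_cat /= !map_cat /= !map_nseq /theta_letter /theta /=.
  by rewrite xab cab inE !eqxx.
- have ac' e e' : noncancel (a, e) (c, e') by apply: noncancel_neq.
  have ca e e' : noncancel (c, e) (a, e') by rewrite noncancel_sym.
  have tail : path (@noncancel G) (c, false)
      (nseq l.+1 (a, true) ++ (c, true) :: nseq q (a, true)).
    rewrite /= ca /=; apply: path_run => //; try exact: noncancel_same.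
    by apply: path_nseq => //; apply: noncancel_same.
  case: p {w} => [|p'] //; rewrite /reduced /=.
  by apply: path_run => //; apply: noncancel_same.
Qed.

End GeodesicWords.

Section EmbedNecessary.
Local Open Scope ring_scope.
Variables (R : realType) (G : sgraph) (k : nat) (T : 'I_k -> sgraph)
  (f : raag G -> forall i, tree_point R (T i)).
Hypotheses (treeT : forall i, is_tree (T i)) (lfT : forall i, locally_finite (T i)).
Hypothesis isom : forall g h : raag G, l1_dist (f g) (f h) = (word_dist g h)%:R.
Local Notation sp := (spell (raag_rels G)).
Implicit Types (g h : raag G).

Let d i g h : R := path_dist (f g i) (f h i).

Let d_ge0 i g h : 0 <= d i g h.
Proof. by have [[r] _ _] := treeT i; apply: (path_dist_ge0 (treeT i) r). Qed.

Let d_refl i g : d i g g = 0. Proof. exact: path_dist_refl. Qed.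

Let d_sym i g h : d i g h = d i h g.
Proof. by have [[r] _ _] := treeT i; apply: (path_dist_sym (treeT i) r). Qed.

Let d_tri i h g g' : d i g g' <= d i g h + d i h g'.
Proof. by have [[r] _ _] := treeT i; apply: (path_dist_triangle (treeT i) r). Qed.

Let d_four i g h g' h' : d i g g' + d i h h' <=
  Num.max (d i g h + d i g' h') (d i h g' + d i g h').
Proof. by have [[r] _ _] := treeT i; apply: (path_dist_four_point (treeT i) r). Qed.

Let d_sum g h : \sum_i d i g h = (word_dist g h)%:R.
Proof. by rewrite -isom. Qed.

(** The defects of the triangle inequality are nonnegative in each coordinate,
    and their sum is the defect in the group. *)
Let additive g h h' g' :
  (word_dist g h + word_dist h h' + word_dist h' g' <= word_dist g g')%N ->
  forall i, d i g g' = d i g h + d i h h' + d i h' g'.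
Proof.
rewrite -(ler_nat R) !natrD -!d_sum => le i.
pose defect j := d j g h + d j h h' + d j h' g' - d j g g'.
have defect_ge0 j : 0 <= defect j.
  by rewrite subr_ge0; have := d_tri j h g g'; have := d_tri j h' h g'; lra.
have z : \sum_j defect j = 0.
  apply/eqP; rewrite eq_le sumr_ge0 ?andbT => [|j _]; last exact: defect_ge0.
  by rewrite !big_split /= sumrN; lra.
have : defect i = 0 by apply: (psumr_eq0P (fun j _ => defect_ge0 j) z).
by rewrite /defect; lra.
Qed.

Let dist_step g w : (word_dist g (g * sp w)%g <= size w)%N.
Proof. by apply: word_dist_le; rewrite mulKg. Qed.

Let split3 g u v w : word_dist g (g * sp (u ++ v ++ w))%g = size (u ++ v ++ w) ->
  forall i, d i g (g * sp u * sp v * sp w)%g =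
    d i g (g * sp u)%g + d i (g * sp u)%g (g * sp u * sp v)%g +
    d i (g * sp u * sp v)%g (g * sp u * sp v * sp w)%g.
Proof.
rewrite !spell_cat !mulgA !size_cat addnA => e; apply: additive.
by rewrite e !leq_add.
Qed.

Let split2 g u v : word_dist g (g * sp (u ++ v))%g = size (u ++ v) ->
  forall i, d i g (g * sp u * sp v)%g = d i g (g * sp u)%g + d i (g * sp u)%g (g * sp u * sp v)%g.
Proof.
rewrite -[v]cats0 => /split3 e i.
by have := e i; rewrite spell_nil !mulg1 d_refl addr0 cats0.
Qed.

Let spV x : sp [:: (x, false)] = (gen x)^-1%g.
Proof. exact: (spell_nseqV x 1). Qed.

Let dist_gen g x : word_dist g (g * gen x)%g = 1%N.
Proof.
rewrite (@word_dist_reduced G _ (fun z => if z == x then Some (x, true) else None)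
  _ _ _ [:: (x, true)] [:: (x, true)]) //.
- by move=> y z u v _; case: (y == x) => // -[<-]; case: (z == x) => // -[<-].
- by rewrite mulKg.
- by rewrite /theta_letter /= eqxx.
Qed.

Let dist_neq0 g x : exists i, d i g (g * gen x)%g != 0.
Proof.
apply: contrapT => none; have := d_sum g (g * gen x)%g.
rewrite dist_gen big1 => [/eqP|i _]; first by rewrite eq_sym oner_eq0.
by apply/eqP/negPn/negP => nz; apply: none; exists i.
Qed.

(** The path from the generator [x] to the generator [y] runs through the
    identity, so in every coordinate the generators form a star. *)
Lemma embed_finite : finite_set [set: G].
Proof.
apply: (@sub_finite_set _ _ (\bigcup_(i in [set: 'I_k]) [set x | d i (gen x) 1%g != 0])).
  by move=> x _; have [i] := dist_neq0 1%g x; rewrite mul1g d_sym => nz; exists i.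
apply: bigcup_finite => [|i _]; first exact: finite_finset.
apply: (star_finite (treeT i) (y := fun x => f (gen x) i) (p := f 1%g i) (@lfT i)) => x y xy.
have := @split2 (gen x) [:: (x, false)] [:: (y, true)].
rewrite spV mulgV mul1g; apply.
by apply: (@two_runs_geodesic _ _ x y false true 1 1); apply/eqP.
Qed.

Section Descent.
Variables (a b c : G).
Hypotheses (ab : adj a b) (nac : ~~ adj a c) (nbc : ~~ adj b c).

Let aNb : a != b. Proof. by apply: contraTneq ab => ->; rewrite adj_irr. Qed.
Let aNc : a != c. Proof. by apply: contraNneq nbc => <-; rewrite adj_sym. Qed.
Let bNc : b != c. Proof. by apply: contraNneq nac => <-. Qed.

Let pow (x : G) (n : nat) : raag G := sp (nseq n (x, true)).

Let powV x n : sp (nseq n (x, false)) = (pow x n)^-1%g. Proof. exact: spell_nseqV. Qed.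

Let pow_commute n m : commute (pow a n) (pow b m).
Proof.
have powE x j : pow x j = (gen x ^+ j)%g.
  by elim: j => // j IH; rewrite expgS -IH /pow [nseq _ _]/= spell_cons.
by rewrite !powE; apply: commuteX2; apply: gen_comm.
Qed.

(** All corners lie on geodesics between their neighbours.  So opposite sides
    are equal and each diagonal is the sum of two sides, which the four point
    condition excludes unless two opposite sides vanish. *)
Lemma rectangle_degenerate i g n m :
  d i g (g * pow a n)%g = 0 \/ d i g (g * pow b m)%g = 0.
Proof.
have bNa : b != a by rewrite eq_sym.
pose q := (g * pow a n)%g; pose s := (g * pow b m)%g; pose t := (g * pow a n * pow b m)%g.
have st : t = (s * pow a n)%g by rewrite /t /s -!mulgA pow_commute.
have runs x y e e' j l h : x != y ->
    let h1 := (h * sp (nseq j (x, e)))%g in let h2 := (h1 * sp (nseq l (y, e')))%g in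
    d i h h2 = d i h h1 + d i h1 h2.
  by move=> xy; apply: split2; rewrite two_runs_geodesic // size_cat !size_nseq.
have gqt : d i g t = d i g q + d i q t by apply: (runs a b true true).
have qts : d i q s = d i q t + d i t s.
  have /= := runs b a true false m n q bNa.
  by rewrite -/(pow b m) powV -[(q * _)%g]/t st mulgK.
have tsg : d i t g = d i t s + d i s g.
  have /= := runs a b false false n m t aNb.
  by rewrite !powV st !mulgK.
have sgq : d i s q = d i s g + d i g q.
  have /= := runs b a false true m n s bNa.
  by rewrite powV mulgK.
have := d_four i g q t s; have := d_ge0 i g q; have := d_ge0 i g s.
rewrite le_max => ? ? /orP four.
rewrite -/q -/s; move: gqt qts tsg sgq four.
rewrite [d i t g]d_sym [d i s g]d_sym [d i s q]d_sym [d i t s]d_sym.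
by move=> ? ? ? ? [] ?; [right|left]; lra.
Qed.

(** Rays rather than lines: one direction is enough for the descent, and the
    exponents stay natural numbers. *)
Let moving x g : {set 'I_k} := [set i | `[< exists n, d i g (g * pow x n)%g != 0 >]].

Let movingP x g i : reflect (exists n, d i g (g * pow x n)%g != 0) (i \in moving x g).
Proof. by rewrite inE; apply: asboolP. Qed.

Let moving_disjoint g i : i \in moving a g -> i \notin moving b g.
Proof.
move=> /movingP[n an]; apply/movingP => -[m bm].
by case: (rectangle_degenerate i g n m) => e; [move: an|move: bm]; rewrite e eqxx.
Qed.

Let moving_neq0 x g : exists i, i \in moving x g.
Proof. by have [i nz] := dist_neq0 g x; exists i; apply/movingP; exists 1%N. Qed.

Let still x g i n : i \notin moving x g -> d i g (g * pow x n)%g = 0.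
Proof. by move=> gi; apply/eqP/negPn/negP => nz; case/movingP: gi; exists n. Qed.

Let base g n := (g * pow a n * gen c)%g.

(** The geodesic from one branch to the other runs along the [a]-ray of [g],
    where the coordinate [i] does not move. *)
Let branch_additive g x i n m p q : x \in [:: a; b] -> i \notin moving a g -> (n < m)%N ->
  d i (base g n * pow x p)%g (base g m * pow x q)%g =
  d i (base g n * pow x p)%g g + d i g (base g m * pow x q)%g.
Proof.
move=> xab gi nm.
set y := (base g n * pow x p)%g; set z := (base g m * pow x q)%g.
set u := nseq p (x, false) ++ [:: (c, false)].
set v := (c, true) :: nseq q (x, true).
set l := (m - n).-1; pose t := nseq l.+1 (a, true).
have yu : (y * sp u)%g = (g * pow a n)%g.
  by rewrite /u spell_cat powV spV mulgA mulgK /base mulgK.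
have yut : (y * sp u * sp t)%g = (g * pow a m)%g.
  rewrite yu -mulgA -[X in _ = (g * X)%g]/(sp _).
  have -> : m = (n + l.+1)%N by rewrite /l; lia.
  by rewrite nseqD spell_cat.
have yutv : (y * sp u * sp t * sp v)%g = z.
  by rewrite yut /v spell_cons mulgA.
have geo : word_dist y (y * sp (u ++ t ++ v))%g = size (u ++ t ++ v).
  rewrite /u -catA; apply: etrans (branch_geodesic y p l q nac nbc aNc bNc xab) _.
  by rewrite !size_cat /= !size_nseq; lia.
have -> : d i y z = d i y (y * sp u)%g + d i (y * sp u)%g (y * sp u * sp t)%g +
    d i (y * sp u * sp t)%g z by rewrite -yutv; apply: split3.
have zero j h : d i h (g * pow a j)%g = d i h g.
  have := still j gi; have := d_tri i g h (g * pow a j)%g.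
  by have := d_tri i (g * pow a j)%g h g; rewrite [d i (g * _)%g g]d_sym; lra.
rewrite yut yu !zero [d i _ g in X in _ + X + _]d_sym.
rewrite still // addr0 [d i (g * _)%g z]d_sym zero.
by rewrite [d i z g]d_sym.
Qed.

(** For each immobile coordinate, the branches that move it form a star around
    the point of [g]; so finitely many of them have to be avoided. *)
Let branch_still g : exists n, forall x i p, x \in [:: a; b] -> i \notin moving a g ->
  d i (base g n * pow x p)%g g = 0.
Proof.
pose bad x i := [set n | exists p, d i (base g n * pow x p)%g g != 0].
have bad_finite x i : x \in [:: a; b] -> i \notin moving a g -> finite_set (bad x i).
  move=> xab gi; pose P n := [set p | d i (base g n * pow x p)%g g != 0].
  (* A point of the [n]-th ray that differs from [g], if the ray moves at all. *)
  pose y n := (base g n * pow x (xget 0%N (P n)))%g.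
  apply: (@sub_finite_set _ _ [set n | d i (y n) g != 0]).
    by move=> n [p np] /=; rewrite /y; case: xgetP => [q _ //|/(_ p)].
  apply: (star_finite (treeT i) (y := fun n => f (y n) i) (p := f g i) (@lfT i)) => n m nm.
  rewrite -/(d i (y n) (y m)) -/(d i (y n) g) -/(d i g (y m)).
  case: (ltngtP n m) => [lt|lt|//]; first exact: branch_additive.
  have e : d i (y m) (y n) = d i (y m) g + d i g (y n) by apply: branch_additive.
  by rewrite [LHS]d_sym e [LHS]addrC; congr (_ + _); apply: d_sym.
have : ~ ([set: nat] `<=` \bigcup_(i in [set i | i \notin moving a g]) (bad a i `|` bad b i)).
  move=> /sub_finite_set fin; apply: infinite_nat; apply: fin.
  apply: bigcup_finite => [|i /= gi]; first exact: finite_finset.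
  by rewrite finite_setU; split; apply: bad_finite => //; rewrite !inE eqxx ?orbT.
move=> /existsNP[n /not_implyP[_ good]]; exists n => x i p xab gi.
apply/eqP/negPn/negP => nz; apply: good; exists i => //.
by move: xab; rewrite !inE => /orP[]/eqP xE; [left|right]; exists p; rewrite -xE.
Qed.

(** The new [a]-ray moves only old coordinates, but not those that move along
    the new [b]-ray, of which there is at least one. *)
Let descend g : exists g', (#|moving a g'| < #|moving a g|)%N.
Proof.
have [n nP] := branch_still g; exists (base g n).
have sub x : x \in [:: a; b] -> moving x (base g n) \subset moving a g.
  move=> xab; apply/fintype.subsetP => i /movingP[p np]; apply: contraNT np => gi.
  have := nP x i p xab gi; have := nP x i 0%N xab gi; rewrite /pow mulg1.
  have := d_tri i g (base g n) (base g n * pow x p)%g.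
  rewrite [d i g _]d_sym => le e0 e1; rewrite eq_le d_ge0 andbT.
  by move: le; rewrite /pow in e1 *; rewrite e0 e1 addr0.
have [i ib] := moving_neq0 b (base g n).
apply: proper_card; apply/properP; split; first by apply: sub; rewrite mem_head.
have bP : b \in [:: a; b] by rewrite !inE eqxx orbT.
exists i; first exact: (fintype.subsetP (sub b bP) i ib).
by apply: contraL ib; apply: moving_disjoint.
Qed.

Lemma edge_and_free_vertex_absurd : False.
Proof.
suff no n g : (#|moving a g| < n)%N -> False by apply: (no _ 1%g (ltnSn _)).
elim: n g => // n IH g gn; have [g' g'g] := descend g.
by apply: (IH g'); apply: leq_trans g'g gn.
Qed.

End Descent.

Lemma embed_nonadj_trans (a b c : G) : adj a b -> adj a c || adj b c.
Proof.
move=> ab; apply: contraT; rewrite negb_or => /andP[ac bc].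
by case: (edge_and_free_vertex_absurd ab ac bc).
Qed.

End EmbedNecessary.

Theorem corollary4p8 (R : realType) (G : sgraph) :
  embeds_in_product_of_lf_trees R G <-> is_product_of_free_groups (raag G).
Proof.
split=> [[k [T [f [tree_lf isom]]]]|[k [r [phi [phi' phiK phiK']]]]].
  have treeT i := (tree_lf i).1; have lfT i := (tree_lf i).2.
  have finG := embed_finite treeT lfT isom.
  have [n [cls clsE]] := nonadj_classes finG (embed_nonadj_trans treeT lfT isom).
  have /finite_seqP[vs vsT] := finG.
  apply: (@classes_product_of_free G vs n cls) => // x.
  by have : [set: G] x by []; rewrite vsT.
have phiM : {morph phi : x y / x * y} by exact: gmulfM.
have finG := product_finite phiM phiK phiK'.
have [n [cls clsE]] := nonadj_classes finG (product_nonadj_trans phiM phiK phiK').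
exact: classes_embed finG clsE.
Qed.
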